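(* There exists $N$ such that whenever $q \ge N$ and $1 \le \Delta \le \frac{\sqrt{q}}{(\log q)^9}$, the following holds. Suppose $G$ is a finite simple graph with maximum degree at most $q$ whose edges are colored (not necessarily properly) such that every color class contains at least $\left(1 + \left(\frac{\Delta^2}{q}\right)^{1/6} (\log q)^2\right) q$ edges, and such that every vertex is incident to at most $\Delta$ edges of any single color. Then $G$ contains a rainbow matching which uses every color.
   Context: A graph is simple (no loops, no parallel edges). An edge-coloring assigns a color to each edge; a color class is the set of edges of a given color. A matching is a set of pairwise vertex-disjoint edges; it is rainbow if its edges have pairwise distinct colors. ''Uses every color'' means the matching contains exactly one edge of each color appearing in the coloring. *)

(* Defs.v *)
From mathcomp Require Import all_boot.

Set Implicit Arguments.
Unset Strict Implicit.
Unset Printing Implicit Defensive.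

(* A finite simple graph on the vertex type T is a symmetric irreflexive
   relation e; an edge is the unordered pair [set x; y] of its endpoints. *)
Definition edges (T : finType) (e : rel T) : {set {set T}} :=
  [set [set p.1; p.2] | p : T * T & e p.1 p.2].

Definition degree (T : finType) (e : rel T) (x : T) : nat :=
  #|[set f in edges e | x \in f]|.

Definition max_degree (T : finType) (e : rel T) : nat :=
  \max_(x : T) degree e x.

(* An edge-coloring is a function c on all vertex sets, of which only the
   values on edges e are ever used; the colors that appear are thus the values
   of c on edges, and not all the elements of C. *)
Definition colors (T : finType) (e : rel T) (C : eqType) (c : {set T} -> C) :
    seq C :=
  [seq c f | f in edges e].

Definition color_class (T : finType) (e : rel T) (C : eqType)
    (c : {set T} -> C) (k : C) : {set {set T}} :=
  [set f in edges e | c f == k].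

Definition color_degree (T : finType) (e : rel T) (C : eqType)
    (c : {set T} -> C) (k : C) (x : T) : nat :=
  #|[set f in color_class e c k | x \in f]|.

Definition is_matching (T : finType) (e : rel T) (M : {set {set T}}) : Prop :=
  M \subset edges e /\ trivIset M.

Definition rainbow (T : finType) (C : eqType) (c : {set T} -> C)
    (M : {set {set T}}) : Prop :=
  {in M &, injective c}.

Definition uses_every_color (T : finType) (e : rel T) (C : eqType)
    (c : {set T} -> C) (M : {set {set T}}) : Prop :=
  forall k : C, k \in colors e c -> #|[set f in M | c f == k]| = 1.

(* Main.v *)
(* Nibble with the Lovasz local lemma at every round. A state is a set of edges
   in which every remaining color has at least (1 + eps) b edges and every vertex
   has degree at most b. In a round each color proposes, with probability th,
   a uniformly random edge of its class; a proposal succeeds if it avoids all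
   proposals made before it in a fixed order, and every proposed vertex is deleted.
   Dummy proposals make each vertex be proposed at the same total rate
   p = th b / n, where n is the common size of the classes. Classes then shrink by
   a factor 1 - 2p, whereas degrees shrink by 1 - p - th, because edges also
   disappear with their colors; as n > b, p < th and the ratio of the two grows:
   eps is multiplied by at least 1 + th / 2 while b loses at most a factor
   1 - 2 th, so that b eps^5 does not decrease. The three random quantities that
   have to be controlled are sums revealed one proposal at a time, hence have
   exponential tails, each depends on boundedly many proposals, and the local lemma
   makes all of them typical at once. Once the ratio exceeds 32, a uniformly random
   choice of one edge per color and one last local lemma finish the proof. *)
Require Import Defs.
From HB Require Import structures.
From mathcomp Require Import all_boot all_order all_algebra.
From mathcomp Require Import all_classical all_reals all_analysis.
From mathcomp Require Import ring lra zify.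
(* restores the finite-set names shadowed by classical_sets *)
From mathcomp Require Import seq fintype finset.

Set Implicit Arguments.
Unset Strict Implicit.
Unset Printing Implicit Defensive.

Import Order.TTheory GRing.Theory Num.Theory.
Local Open Scope ring_scope.

(** * Averages over finite product measures *)

Section ProductAverage.
Variables (R : realType) (I W : finType) (mu : I -> W -> R).
Hypothesis mu_ge0 : forall i x, 0 <= mu i x.
Hypothesis mu_sum1 : forall i, \sum_x mu i x = 1.

Implicit Types (w : {ffun I -> W}) (f g : {ffun I -> W} -> R) (s : seq I).

Definition upd w i x : {ffun I -> W} := [ffun j => if j == i then x else w j].

Definition avg i f w := \sum_x mu i x * f (upd w i x).

(** A conditional expectation: coordinates in [s] are resampled, the others keep their value in [w].
    The head of [s] is averaged outermost, so it is the one revealed first. *)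
Definition avgs s f := foldr avg f s.

Definition indep (V : Type) i (f : {ffun I -> W} -> V) :=
  forall w x, f (upd w i x) = f w.

Lemma updE w i x j : upd w i x j = if j == i then x else w j.
Proof. by rewrite ffunE. Qed.

Lemma upd_upd w i x y : upd (upd w i x) i y = upd w i y.
Proof. by apply/ffunP => j; rewrite !updE; case: eqP. Qed.

Lemma updC w i j x y :
  i != j -> upd (upd w i x) j y = upd (upd w j y) i x.
Proof.
move=> ij; apply/ffunP => k; rewrite !updE.
by case: (eqVneq k j) => [->|//]; rewrite eq_sym (negbTE ij).
Qed.

Lemma eq_avg i f g w : f =1 g -> avg i f w = avg i g w.
Proof. by move=> fg; apply: eq_bigr => x _; rewrite fg. Qed.

Lemma eq_avgs s f g w : f =1 g -> avgs s f w = avgs s g w.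
Proof. by move=> fg; congr (avgs s _ w); apply/boolp.funext. Qed.

Lemma le_avg i f g w : (forall w, f w <= g w) -> avg i f w <= avg i g w.
Proof. by move=> fg; apply: ler_sum => x _; apply: ler_wpM2l. Qed.

Lemma le_avgs s f g w : (forall w, f w <= g w) -> avgs s f w <= avgs s g w.
Proof.
move=> fg; elim: s w => [|i s IH] w //=.
by apply: le_avg => w'; apply: IH.
Qed.

Lemma le_avgs_in s f g w :
  (forall v : {ffun I -> W},
    (forall i, i \notin s -> v i = w i) -> f v <= g v) ->
  avgs s f w <= avgs s g w.
Proof.
elim: s w => [|i s IH] w fg /=; first exact: fg.
apply: ler_sum => x _; apply: ler_wpM2l => //; apply: IH => v vE.
apply: fg => j; rewrite inE negb_or => /andP[ji js].
by rewrite vE // updE (negbTE ji).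
Qed.

Lemma avg_cst i (a : R) w : avg i (fun=> a) w = a.
Proof. by rewrite /avg -mulr_suml mu_sum1 mul1r. Qed.

Lemma avgs_cst s (a : R) w : avgs s (fun=> a) w = a.
Proof.
elim: s w => [|i s IH] w //=.
by rewrite -[RHS](avg_cst i a w); apply: eq_avg => w'.
Qed.

Lemma avgs_ge0 s f w : (forall w, 0 <= f w) -> 0 <= avgs s f w.
Proof. by move=> f0; rewrite -(avgs_cst s 0 w); apply: le_avgs. Qed.

Lemma avgD i f g w : avg i (fun w => f w + g w) w = avg i f w + avg i g w.
Proof. by rewrite /avg -big_split; apply: eq_bigr => x _; rewrite mulrDr. Qed.

Lemma avgsD s f g w : avgs s (fun w => f w + g w) w = avgs s f w + avgs s g w.
Proof.
elim: s w => [|i s IH] w //=.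
by rewrite -avgD; apply: eq_avg => w'; exact: IH.
Qed.

Lemma avgZ i (a : R) f w : avg i (fun w => a * f w) w = a * avg i f w.
Proof. by rewrite /avg mulr_sumr; apply: eq_bigr => x _; rewrite mulrCA. Qed.

Lemma avgsZ s (a : R) f w : avgs s (fun w => a * f w) w = a * avgs s f w.
Proof.
elim: s w => [|i s IH] w //=.
by rewrite -avgZ; apply: eq_avg => w'; exact: IH.
Qed.

Lemma avgsB s f g w : avgs s (fun w => f w - g w) w = avgs s f w - avgs s g w.
Proof.
rewrite (@eq_avgs _ _ (fun w => f w + -1 * g w)) => [|w'].
  by rewrite avgsD avgsZ mulN1r.
by rewrite mulN1r.
Qed.

Lemma avgs_sum s (J : finType) (P : pred J) (F : J -> {ffun I -> W} -> R) w :
  avgs s (fun w => \sum_(j | P j) F j w) w = \sum_(j | P j) avgs s (F j) w.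
Proof.
elim: s w => [|i s IH] w //=.
rewrite (@eq_avg _ _ (fun w => \sum_(j | P j) avgs s (F j) w)) //.
rewrite /avg exchange_big /=; apply: eq_bigr => x _.
by rewrite mulr_sumr.
Qed.

Lemma indep_avg i j f : indep i f -> indep i (avg j f).
Proof.
move=> fi w x; apply: eq_bigr => y _; congr (_ * _).
case: (eqVneq i j) => [->|ij]; first by rewrite upd_upd.
by rewrite updC // fi.
Qed.

Lemma indep_avgs s i f : indep i f -> indep i (avgs s f).
Proof. by move=> fi; elim: s => [|j s IH] //=; apply: indep_avg. Qed.

Lemma avgMl i f g w :
  indep i f -> avg i (fun w => f w * g w) w = f w * avg i g w.
Proof.
by move=> fi; rewrite /avg mulr_sumr; apply: eq_bigr => x _; rewrite fi mulrCA.
Qed.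

Lemma avg_id i f w : indep i f -> avg i f w = f w.
Proof.
move=> fi; rewrite -[RHS]mulr1 -(avg_cst i 1 w) -avgMl //.
by apply: eq_avg => w'; rewrite mulr1.
Qed.

Lemma avgsMl s f g w : (forall i, i \in s -> indep i f) ->
  avgs s (fun w => f w * g w) w = f w * avgs s g w.
Proof.
elim: s w => [|i s IH] w fs //=; rewrite -avgMl; last first.
  by apply: fs; rewrite mem_head.
by apply: eq_avg => w'; apply: IH => j js; apply: fs; rewrite inE js orbT.
Qed.

Lemma avgs_id s f w : (forall i, i \in s -> indep i f) -> avgs s f w = f w.
Proof.
move=> fs; rewrite -[RHS]mulr1 -(avgs_cst s 1 w) -avgsMl //.
by apply: eq_avgs => w'; rewrite mulr1.
Qed.

(** At each integration one of the two factors is constant and leaves the average. *)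
Lemma avgs_indepM s f g w :
  (forall i, i \in s -> indep i f \/ indep i g) ->
  avgs s (fun w => f w * g w) w = avgs s f w * avgs s g w.
Proof.
elim: s w => [|i s IH] w fg //=.
rewrite (@eq_avg _ _ (fun w => avgs s f w * avgs s g w)); last first.
  by move=> w'; apply: IH => j js; apply: fg; rewrite inE js orbT.
have [fi|gi] := fg i (mem_head _ _).
  by rewrite avgMl ?(avg_id _ (indep_avgs s fi)) //; apply: indep_avgs.
rewrite (@eq_avg _ _ (fun w => avgs s g w * avgs s f w)); last first.
  by move=> w'; rewrite mulrC.
by rewrite avgMl ?(avg_id _ (indep_avgs s gi)) 1?mulrC //; apply: indep_avgs.
Qed.

Lemma avgs_coord s k (G : W -> R) w : uniq s -> k \in s ->
  avgs s (fun w => G (w k)) w = \sum_x mu k x * G x.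
Proof.
elim: s w => [//|i s IH] w /= /andP[is_ us]; rewrite inE.
case: eqVneq => [-> _|ki /= ks]; last first.
  by rewrite -[RHS](avg_cst i _ w); apply: eq_avg => v; apply: IH.
apply: eq_bigr => x _; rewrite avgs_id ?updE ?eqxx // => j js v y.
by rewrite updE; case: eqP is_ => // ->; rewrite js.
Qed.

(** The probabilistic method; positive mass of the resampled coordinates is kept in order to exclude
    null values later. *)
Lemma avgs_gt0_ex s f w : uniq s -> (forall w, 0 <= f w) -> 0 < avgs s f w ->
  exists w', [/\ forall i, i \notin s -> w' i = w i,
    forall i, i \in s -> 0 < mu i (w' i) & 0 < f w'].
Proof.
move=> us f0; elim: s us w => [|i s IH] /=; first by move=> _ w fw; exists w.
move=> /andP[is_ us] w; rewrite /avg => avg_gt0.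
have [x [mx fx]] : exists x, 0 < mu i x /\ 0 < avgs s f (upd w i x).
  apply: contrapT => none; move: avg_gt0; apply/negP; rewrite -leNgt.
  apply: sumr_le0 => x _; have := mu_ge0 i x.
  rewrite le_eqVlt => /orP[/eqP<-|mx]; first by rewrite mul0r.
  rewrite pmulr_rle0 // leNgt; apply/negP => fx; apply: none.
  by exists x.
have [w' [out inn fw']] := IH us _ fx; exists w'; split=> // j.
  rewrite inE negb_or => /andP[ji js].
  by rewrite out // updE (negbTE ji).
rewrite inE; case: (boolP (j \in s)) => [js _|js]; first exact: inn.
by rewrite orbF => /eqP->; rewrite out // updE eqxx.
Qed.

End ProductAverage.

(** * The local lemma *)

Section LocalLemma.
Variables (R : realType) (I W J : finType) (mu : I -> W -> R).
Hypothesis mu_ge0 : forall i x, 0 <= mu i x.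
Hypothesis mu_sum1 : forall i, \sum_x mu i x = 1.

Variables (bad : J -> {ffun I -> W} -> bool) (S : J -> {set I}).
Variables (p D : R) (w0 : {ffun I -> W}).
Hypothesis bad_local : forall j i, i \notin S j -> indep i (bad j).
Hypothesis bad_prob :
  forall j, avgs mu (enum I) (fun w => (bad j w)%:R) w0 <= p.
Hypothesis few_dep :
  forall j, #|[set j' | ~~ [disjoint S j & S j']]|%:R <= D.
Hypothesis p_small : p <= 1 / 4.
Hypothesis pD_small : 4 * p * D <= 1.

Local Notation E f := (avgs mu (enum I) f w0).

Let good (X : {set J}) (w : {ffun I -> W}) : R :=
  \prod_(j in X) (~~ bad j w)%:R.

Let good_ge0 X w : 0 <= good X w.
Proof. by apply: prodr_ge0 => j _; apply: ler0n. Qed.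

Let good_le1 X w : good X w <= 1.
Proof. by apply: Num.Theory.prodr_ile1 => j _; rewrite ler0n lern1 leq_b1. Qed.

Let indep_bad i (j : J) : i \notin S j ->
  indep i (fun w => (bad j w)%:R : R).
Proof. by move=> iS w x; rewrite bad_local. Qed.

Let indep_good (X : {set J}) i : (forall j, j \in X -> i \notin S j) -> indep i (good X).
Proof.
by move=> XS w x; apply: eq_bigr => j jX; rewrite bad_local // XS.
Qed.

Let p_ge0 (j : J) : 0 <= p.
Proof. by apply: le_trans (bad_prob j); apply: avgs_ge0 => // w; apply: ler0n. Qed.

Let far_bad j (X : {set J}) : (forall l, l \in X -> [disjoint S j & S l]) ->
  E (fun w => (bad j w)%:R * good X w) <= p * E (good X).
Proof.
move=> dis; rewrite avgs_indepM //; first last.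
  move=> i _; case: (boolP (i \in S j)) => iS; [right | left].
    by apply: indep_good => l lX; by rewrite (disjointFr (dis l lX) iS).
  exact: indep_bad.
by apply: ler_wpM2r; [apply: avgs_ge0 | apply: bad_prob].
Qed.

(** The union bound over [X], given that no event of [Y] occurs. *)
Let good_split (X Y : {set J}) w : [disjoint X & Y] ->
  good Y w - \sum_(l in X) (bad l w)%:R * good Y w <= good (X :|: Y) w.
Proof.
move=> dXY; have -> : good (X :|: Y) w = good X w * good Y w.
  rewrite /good -(bigU _ _ _ dXY) /=; apply: eq_bigl => l.
  by rewrite !inE.
rewrite -mulr_suml -{1}[good Y w]mul1r -mulrBl ler_wpM2r //.
case: (boolP [exists l in X, bad l w]) => [/exists_inP[l lX bl]|].
  apply: le_trans (good_ge0 _ _).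
  rewrite (bigD1 l) //= bl opprD addrA subrr sub0r oppr_le0.
  by apply: sumr_ge0 => k _; apply: ler0n.
rewrite negb_exists_in => /forall_inP nb.
rewrite big1 => [|l lX]; last by rewrite (negbTE (nb l lX)).
by rewrite /good big1 ?subr0 // => l lX; rewrite nb.
Qed.

(** The usual induction: given that no event of [X] occurs, [bad j] has probability at most [2 * p].
    Multiplying out avoids dividing by a mass not yet known to be positive. *)
Let cond_bad m : forall (X : {set J}) j, (#|X| <= m)%N -> j \notin X ->
  E (fun w => (bad j w)%:R * good X w) <= 2 * p * E (good X).
Proof.
elim: m => [|m IH] X j.
  rewrite leqn0 cards_eq0 => /eqP-> _.
  apply: le_trans (far_bad _) _ => [l|]; first by rewrite inE.
  rewrite -mulrA ler_peMl ?mulr_ge0 ?(p_ge0 j) ?avgs_ge0 //.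
  by rewrite ler1n.
move=> Xm jX; pose N := [set l | ~~ [disjoint S j & S l]].
have dis l : l \in X :\: N -> [disjoint S j & S l].
  by rewrite !inE negbK => /andP[].
have p0 := p_ge0 j.
have Efar := far_bad dis.
have [XN0|] := eqVneq (X :&: N) set0.
  have XE : X :\: N = X by rewrite -[RHS](setID X N) XN0 set0U.
  rewrite XE in Efar; apply: le_trans Efar _.
  rewrite -mulrA ler_peMl ?mulr_ge0 ?avgs_ge0 //.
  by rewrite ler1n.
move=> XN.
have sub : E (fun w => (bad j w)%:R * good X w)
     <= E (fun w => (bad j w)%:R * good (X :\: N) w).
  apply: le_avgs => // w; apply: ler_wpM2l; first exact: ler0n.
  rewrite /good (big_setID N) /= ler_piMl ?good_ge0 //.
  exact: good_le1.
apply: le_trans sub (le_trans Efar _).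
have [l0 l0XN] := set0Pn _ XN.
have lt : (#|X :\: N| <= m)%N.
  rewrite -ltnS; apply: leq_trans Xm; rewrite -(cardsID N X) -addn1 addnC leq_add2r.
  by rewrite card_gt0.
(* Reinstating the neighbours of [j] costs at most the factor [1 - 2 * p * D], which is at least
   1/2; this is the origin of the 2 in [2 * p]. *)
have lower : (1 - 2 * p * D) * E (good (X :\: N)) <= E (good X).
  have -> : good X = good ((X :&: N) :|: (X :\: N)) by rewrite setID.
  apply: (@le_trans _ _ (E (fun w => good (X :\: N) w
      - \sum_(l in X :&: N) (bad l w)%:R * good (X :\: N) w))); last first.
    apply: le_avgs => // w; apply: good_split.
    apply/pred0P => l /=; rewrite in_setI in_setD.
    by case: (l \in N); rewrite ?andbF.
  rewrite avgsB // avgs_sum // mulrBl mul1r lerB //.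
  apply: (@le_trans _ _ (\sum_(l in X :&: N) 2 * p * E (good (X :\: N)))).
    apply: ler_sum => l /setIP[lX lN]; apply: IH => //.
    by rewrite in_setD lN.
  rewrite sumr_const -[_ *+ #|_|]mulr_natr [leRHS]mulrAC; apply: ler_wpM2l.
    by rewrite !mulr_ge0 ?avgs_ge0.
  apply: le_trans (few_dep j); rewrite ler_nat.
  by apply: subset_leq_card; apply: subsetIr.
apply: le_trans (ler_wpM2l _ lower); last by rewrite mulr_ge0.
rewrite mulrA ler_wpM2r ?avgs_ge0 //.
have : p * (4 * p * D) <= p * 1 by apply: ler_wpM2l.
by nra.
Qed.

(** Adding the events one at a time keeps at least a fraction [1 - 2 * p] of the good mass, which
    therefore never vanishes. *)
Lemma local_lemma : exists w : {ffun I -> W},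
  (forall i, 0 < mu i (w i)) /\ (forall j, ~~ bad j w).
Proof.
have pos m : forall X : {set J}, #|X| = m -> 0 < E (good X).
  elim: m => [|m IH] X Xm.
    move/eqP: Xm; rewrite cards_eq0 => /eqP->.
    rewrite (@eq_avgs _ _ _ _ _ _ (fun=> 1)) ?avgs_cst // => w.
    by rewrite /good big_set0.
  have [j jX] : exists j, j \in X by apply/set0Pn; rewrite -card_gt0 Xm.
  have cX : #|X :\ j| = m by apply/eqP; rewrite -eqSS -Xm (cardsD1 j X) jX.
  have EX : E (good X)
      = E (good (X :\ j)) - E (fun w => (bad j w)%:R * good (X :\ j) w).
    rewrite -avgsB; apply: eq_avgs => w; rewrite /good (big_setD1 j) //=.
    by case: (bad j w); rewrite ?mul0r ?mul1r ?subrr ?subr0.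
  have := IH _ cX; have := @cond_bad m (X :\ j) j.
  rewrite cX leqnn setD11 => /(_ isT isT); rewrite EX.
  move=> le_bad pos_good; rewrite subr_gt0; apply: le_lt_trans le_bad _.
  by rewrite gtr_pMl //; move: p_small; lra.
have [w [_ supp]] := avgs_gt0_ex (f := good setT) (s := enum I)
   mu_ge0 (enum_uniq _) (good_ge0 _) (pos _ setT erefl).
move=> gw; exists w; split=> [i|j]; first by apply: supp; rewrite mem_enum.
apply/negP => bj; move: gw; rewrite /good (bigD1 j) //= bj mul0r ltxx //.
Qed.

End LocalLemma.

(** * Exponential tails *)

Lemma natr_cardI (R : realType) (X : finType) (U V : {set X}) :
  #|U :&: V|%:R = \sum_(f in U) (f \in V)%:R :> R.
Proof.
rewrite -sum1_card natr_sum (eq_bigl (fun f : X => (f \in U) && (f \in V))).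
  by rewrite big_mkcondr; apply: eq_bigr => f _; case: (f \in V).
by move=> f; rewrite inE.
Qed.

Section ExponentialTails.
Variables (R : realType) (I W : finType) (mu : I -> W -> R).
Hypothesis mu_ge0 : forall i x, 0 <= mu i x.
Hypothesis mu_sum1 : forall i, \sum_x mu i x = 1.

Implicit Types (w : {ffun I -> W}) (f : {ffun I -> W} -> R).

Lemma expR_le_quad (t : R) : 0 <= t -> t <= 1 / 2 ->
  expR t <= 1 + t + 2 * t ^+ 2.
Proof.
move=> t0 t12; have t1 : 0 < 1 - t by lra.
rewrite -(ler_pM2l t1); apply: (@le_trans _ _ 1); last by nra.
by rewrite -ler_pdivlMr ?expR_gt0 // div1r -expRN expR_ge1Dx.
Qed.

Lemma expRN_le_quad (t : R) : 0 <= t -> expR (- t) <= 1 - t + t ^+ 2.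
Proof.
move=> t0; rewrite expRN -[leLHS]mul1r ler_pdivrMr ?expR_gt0 //.
have := expR_ge1Dx t => h; apply: le_trans (ler_wpM2l _ h); nra.
Qed.

Lemma markov_expR s f (lam t : R) w : 0 <= lam ->
  avgs mu s (fun w => (t <= f w)%R%:R) w
    <= expR (- (lam * t)) * avgs mu s (fun w => expR (lam * f w)) w.
Proof.
move=> lam0; rewrite -avgsZ; apply: le_avgs => // w'.
rewrite -expRD; case: (leP t (f w')) => [tf|_]; last by rewrite expR_ge0.
rewrite -(expR0 R) ler_expR addrC subr_ge0.
exact: ler_wpM2l.
Qed.

(** A supermartingale argument: each factor is fixed once its own coordinate is revealed, so it
    leaves the averages over later ones. *)
Lemma seq_expR_le1 s (h : I -> {ffun I -> W} -> R) w :
  (forall s1 i s2, s = s1 ++ i :: s2 -> forall j, j \in s2 -> indep j (h i)) ->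
  (forall i w, avg mu i (fun w => expR (h i w)) w <= 1) ->
  avgs mu s (fun w => expR (\sum_(i <- s) h i w)) w <= 1.
Proof.
move=> + h1; elim: s w => [|i s IH] w ind /=.
  by rewrite big_nil expR0.
apply: le_trans (h1 i w); apply: le_avg => // w'.
rewrite (@eq_avgs _ _ _ _ _ _ (fun w => expR (h i w) *
    expR (\sum_(i <- s) h i w))); last first.
  by move=> v; rewrite big_cons expRD.
rewrite avgsMl; last first.
  by move=> j js v x; rewrite (ind [::] i s erefl j js).
rewrite ler_piMr ?expR_ge0 //; apply: IH => s1 k s2 sE.
by apply: (ind (i :: s1)); rewrite sE.
Qed.

(** A Chernoff bound for adapted sums: a bound [m i] on the mean given any past replaces
    independence of the summands. *)
Lemma seq_upper_tail s (g : I -> {ffun I -> W} -> R) (m : I -> R) (c lam t : R) w :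
  (forall i w, 0 <= g i w <= c) ->
  0 <= lam -> lam * c <= 1 / 2 ->
  (forall s1 i s2, s = s1 ++ i :: s2 -> forall j, j \in s2 -> indep j (g i)) ->
  (forall i w, avg mu i (g i) w <= m i) ->
  avgs mu s (fun w => (t <= \sum_(i <- s) g i w)%R%:R) w
    <= expR (lam * (1 + 2 * (lam * c)) * (\sum_(i <- s) m i) - lam * t).
Proof.
move=> gc lam0 lamc ind gm.
apply: le_trans (markov_expR _ _ _ _ lam0) _; rewrite addrC expRD ler_wpM2l ?expR_ge0 //.
(* Since exp(t) <= 1 + t + 2t^2 and [lam * g i w <= lam * c], each exp([lam * g i w]) is at most
   [1 + a * g i w]. *)
pose a := lam * (1 + 2 * (lam * c)).
have c0 : forall i : I, 0 <= c by move=> i; have /andP[] := gc i w; exact: le_trans.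
rewrite -/a (@eq_avgs _ _ _ _ _ _ (fun w => expR (a * \sum_(i <- s) m i) *
   expR (\sum_(i <- s) (lam * g i w - a * m i)))); last first.
  by move=> v; rewrite -expRD sumrB -!mulr_sumr addrC subrK.
rewrite avgsZ ler_piMr ?expR_ge0 //; apply: seq_expR_le1.
  by move=> s1 i s2 sE j js v x; rewrite (ind _ _ _ sE _ js).
move=> i v; have a0 : 0 <= a by rewrite /a !(mulr_ge0,addr_ge0) ?(c0 i).
apply: (@le_trans _ _ (expR (- (a * m i)) * avg mu i (fun w => 1 + a * g i w) v)).
  rewrite -avgZ; apply: le_avg => // u; rewrite addrC expRD ler_wpM2l ?expR_ge0 //.
  have /andP[g0 gle] := gc i u.
  have le1 : lam * g i u <= lam * c by apply: ler_wpM2l.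
  apply: le_trans (expR_le_quad _ (le_trans le1 lamc)) _; first exact: mulr_ge0.
  have : (lam * g i u) * (lam * g i u) <= (lam * g i u) * (lam * c).
    by apply: ler_wpM2l => //; apply: mulr_ge0.
  by clear c0; rewrite /a; nra.
rewrite expRN -ler_pdivlMl ?invr_gt0 ?expR_gt0 // invrK mulr1.
apply: le_trans (expR_ge1Dx _).
have -> : avg mu i (fun w => 1 + a * g i w) v = 1 + a * avg mu i (g i) v.
  by rewrite avgD avg_cst // avgZ.
by rewrite lerD2l ler_wpM2l.
Qed.

(** * Elements that escape a sequence of random hits *)

Section Unhit.
Variables (X : finType) (Hit : I -> W -> {set X}).

Definition hit_prob (i : I) (f : X) : R := \sum_x mu i x * (f \in Hit i x)%:R.

Definition unhit s (U : {set X}) w : {set X} :=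
  [set f in U | all (fun i => f \notin Hit i (w i)) s].

Lemma hit_prob_ge0 i (f : X) : 0 <= hit_prob i f.
Proof. by apply: sumr_ge0 => x _; rewrite mulr_ge0. Qed.

(* The weight of an unhit element counts the hitting probability it has
   survived, so the lower tail of the number of hits comes out together with
   the number of survivors. *)
Lemma unhit_expR (c lam : R) s (U : {set X}) w : uniq s ->
  0 <= lam -> lam * c <= 1 ->
  (forall i x, #|U :&: Hit i x|%:R <= c) ->
  avgs mu s (fun w => expR (lam * \sum_(f in unhit s U w)
     (1 + (1 - lam * c) * \sum_(i <- s) hit_prob i f))) w
  <= expR (lam * #|U|%:R).
Proof.
move=> + lam0 lamc; elim: s U w => [|i s IH] U w.
  move=> _ _ /=; rewrite ler_expR ler_wpM2l //.
  under eq_bigr do rewrite big_nil mulr0 addr0.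
  rewrite sumr_const ler_nat; apply: subset_leq_card.
  by apply/subsetP => f; rewrite inE => /andP[].
move=> /= /andP[is_ us] cU; set kap := 1 - lam * c.
have kap0 : 0 <= kap by rewrite subr_ge0.
pose Q := \sum_(f in U) hit_prob i f.
have Q0 : 0 <= Q by apply: sumr_ge0 => f _; apply: hit_prob_ge0.
(* The elements still unhit at the end lie in [U], so their weights gain at most [kap * Q] from
   coordinate [i]. *)
apply: (@le_trans _ _ (avg mu i (fun w => expR (lam * kap * Q) *
     expR (lam * #|U :\: Hit i (w i)|%:R)) w)).
  apply: le_avg => // w'.
  pose V := U :\: Hit i (w' i).
  apply: (@le_trans _ _ (avgs mu s (fun w => expR (lam * kap * Q) *
     expR (lam * \sum_(f in unhit s V w)
       (1 + kap * \sum_(i <- s) hit_prob i f))) w')).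
    apply: le_avgs_in => // v vE; rewrite -expRD ler_expR.
    have -> : unhit (i :: s) U v = unhit s V v.
      by apply/setP => f; rewrite !inE /= (vE _ is_); case: (f \in U); rewrite ?andbF ?andbT.
    rewrite -mulrA -mulrDr ler_wpM2l //.
    under eq_bigr do rewrite big_cons mulrDr addrCA.
    rewrite big_split /= lerD2r -mulr_sumr ler_wpM2l //.
    rewrite [leRHS](bigID (mem (unhit s V v))) /=.
    rewrite (eq_bigl (fun f : X => (f \in U) && (f \in unhit s V v))) => [|f].
      by rewrite lerDl; apply: sumr_ge0 => f _; apply: hit_prob_ge0.
    by rewrite !inE; case: (f \in U); rewrite ?andbF.
  rewrite avgsZ ler_wpM2l ?expR_ge0 //; apply: IH => // j x.
  apply: le_trans (cU j x); rewrite ler_nat; apply: subset_leq_card.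
  by apply: setSI; apply: subsetDl.
rewrite avgZ.
(* Hitting g elements lowers the count by g, and [kap] absorbs the quadratic error of exp(-[lam] g)
   because g <= [c]. As g has mean [Q], this loss cancels the gain exp([lam * kap * Q]). *)
have le_exp x : expR (lam * #|U :\: Hit i x|%:R)
    <= expR (lam * #|U|%:R) * (1 - lam * kap * #|U :&: Hit i x|%:R).
  have -> : #|U|%:R = #|U :\: Hit i x|%:R + #|U :&: Hit i x|%:R :> R.
    by rewrite -(cardsID (Hit i x) U) natrD addrC.
  set g : R := #|U :&: _|%:R.
  rewrite [lam * (_ + _)]mulrDr expRD -mulrA ler_peMr ?expR_ge0 //.
  rewrite -ler_pdivrMl ?expR_gt0 // mulr1 -expRN.
  have g0 : 0 <= g by apply: ler0n.
  apply: le_trans (expRN_le_quad (mulr_ge0 lam0 g0)) _.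
  have : lam * g * (lam * g) <= lam * g * (lam * c).
    by rewrite ler_wpM2l ?mulr_ge0 // ler_wpM2l // cU.
  by rewrite /kap; nra.
have EQ : avg mu i (fun w => (#|U :&: Hit i (w i)|%:R : R)) w = Q.
  rewrite /avg /Q /hit_prob exchange_big /=; apply: eq_bigr => x _.
  by rewrite -mulr_sumr updE eqxx natr_cardI.
apply: (@le_trans _ _ (expR (lam * kap * Q) * (expR (lam * #|U|%:R) *
     (1 + - (lam * kap) * Q)))).
  rewrite ler_wpM2l ?expR_ge0 // -EQ -avgZ.
  rewrite -[X in X + _](avg_cst mu_sum1 i 1 w) -avgD -avgZ; apply: le_avg => // w'.
  by rewrite mulNr le_exp.
rewrite [leLHS]mulrCA ler_piMr ?expR_ge0 // mulNr -ler_pdivlMl ?expR_gt0 // mulr1.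
by rewrite -expRN expR_ge1Dx.
Qed.

End Unhit.
End ExponentialTails.

(** * Edge-colored graphs and the dense case *)

Section PickMeasure.
Variables (R : realType) (I W : finType) (q : I -> R) (supp : I -> {set W}) (d : W).
Hypothesis q_ge0 : forall i, 0 <= q i.
Hypothesis q_le1 : forall i, q i * #|supp i|%:R <= 1.

(** Used twice: in the dense case no mass is left on [d] for a color of [A], while in the nibble [d]
    stands for making no proposal. *)
Definition pick_mu i x : R :=
  q i * (x \in supp i)%:R + (1 - q i * #|supp i|%:R) * (x == d)%:R.

Lemma pick_mu_ge0 i x : 0 <= pick_mu i x.
Proof. by rewrite addr_ge0 // mulr_ge0 // subr_ge0. Qed.

Lemma pick_muE i (g : W -> R) : \sum_x pick_mu i x * g x =
  q i * (\sum_(x in supp i) g x) + (1 - q i * #|supp i|%:R) * g d.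
Proof.
under eq_bigr do rewrite mulrDl; rewrite big_split /=; congr (_ + _).
  rewrite mulr_sumr [RHS]big_mkcond; apply: eq_bigr => x _.
  by case: (x \in supp i); rewrite ?mulr1 ?mulr0 ?mul0r.
rewrite (bigD1 d) //= eqxx mulr1 big1 ?addr0 // => x /negbTE->.
by rewrite mulr0 mul0r.
Qed.

Lemma pick_mu_sum1 i : \sum_x pick_mu i x = 1.
Proof.
transitivity (\sum_x pick_mu i x * 1); first by apply: eq_bigr => x; rewrite mulr1.
by rewrite pick_muE sumr_const mulr1 addrC subrK.
Qed.

End PickMeasure.

Section ColoredEdges.
Variables (R : realType) (K T : finType) (col : {set T} -> K).
Implicit Types (F : {set {set T}}) (A : {set K}) (k : K) (v : T).

Definition cls F k : {set {set T}} := [set f in F | col f == k].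

Definition deg F v : nat := #|[set f in F | v \in f]|.

(** The rainbow matching is given as a choice function, which is easily glued from the colors served
    in a round and those served later. *)
Definition full F A : Prop := exists phi : K -> {set T},
  (forall k, k \in A -> phi k \in cls F k) /\
  (forall k l, k \in A -> l \in A -> k != l -> [disjoint phi k & phi l]).

Record config F A (n : nat) (b Dl : R) : Prop := Config {
  card2 : forall f, f \in F -> #|f| = 2%N;
  col_in : forall f, f \in F -> col f \in A;
  cls_card : forall k, k \in A -> #|cls F k| = n;
  deg_le : forall v, (deg F v)%:R <= b;
  cdeg_le : forall k v, (deg (cls F k) v)%:R <= Dl }.

Lemma clsP F k f : reflect (f \in F /\ col f = k) (f \in cls F k).
Proof. by rewrite inE; apply: (iffP andP) => -[? /eqP]. Qed.

Lemma deg_sub F F' v : F' \subset F -> (deg F' v <= deg F v)%N.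
Proof.
move=> sF; apply: subset_leq_card; apply/subsetP => f; rewrite !inE.
by move=> /andP[/(subsetP sF)-> ->].
Qed.

Lemma cls_sub F F' k : F' \subset F -> cls F' k \subset cls F k.
Proof.
move=> sF; apply/subsetP => f; rewrite !inE.
by move=> /andP[/(subsetP sF)-> ->].
Qed.

Lemma sub_cls F k : cls F k \subset F.
Proof. by apply/subsetP => f /clsP[]. Qed.

Lemma meet_le F (X : {set T}) :
  (#|[set f in F | ~~ [disjoint f & X]]| <= \sum_(u in X) deg F u)%N.
Proof.
rewrite (eq_bigr (fun u => (\sum_(f in F) (u \in f))%N)) => [|u _]; last first.
  rewrite /deg -sum1_card big_mkcond [RHS]big_mkcond; apply: eq_bigr => f _.
  by rewrite inE; case: (f \in F); case: (u \in f).
rewrite exchange_big /= -sum1_card big_mkcond [leqRHS]big_mkcond /=.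
apply: leq_sum => f _; rewrite inE; case: (f \in F) => //=.
case: (boolP [disjoint f & X]) => //= /pred0Pn[u /= /andP[uf uX]].
by rewrite (bigD1 u) //= uf.
Qed.

Lemma sum_cdeg F v : (\sum_k deg (cls F k) v)%N = deg F v.
Proof.
rewrite /deg -sum1_card (partition_big col xpredT) //=; apply: eq_bigr => k _.
by rewrite -sum1_card; apply: eq_bigl => f; rewrite !inE andbAC.
Qed.

(** Keeping the first [n] edges of each class in a fixed enumeration only lowers degrees, and a
    matching found there is one of [F]. *)
Lemma truncate F A (n : nat) (b Dl : R) :
  (forall f, f \in F -> #|f| = 2%N) -> (forall f, f \in F -> col f \in A) ->
  (forall k, k \in A -> (n <= #|cls F k|)%N) ->
  (forall v, (deg F v)%:R <= b) -> (forall k v, (deg (cls F k) v)%:R <= Dl) ->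
  exists F', config F' A n b Dl /\ (full F' A -> full F A).
Proof.
move=> c2 ci cn db cd.
pose F' := [set f in F | f \in take n (enum (cls F (col f)))].
have sF : F' \subset F by apply/subsetP => f; rewrite inE => /andP[].
exists F'; split; last first.
  move=> [phi [pc pd]]; exists phi; split=> // k kA.
  by apply: (subsetP (cls_sub k sF)); apply: pc.
split.
- by move=> f /(subsetP sF); apply: c2.
- by move=> f /(subsetP sF); apply: ci.
- move=> k kA; have -> : #|cls F' k| = #|[set f in take n (enum (cls F k))]|.
    apply: eq_card => f; rewrite !inE; case: (eqVneq (col f) k) => [<-|nk].
      rewrite andbT; case: (boolP (f \in take _ _)) => [/mem_take|_].
        by rewrite mem_enum inE => /andP[->].
      by rewrite andbF.
    rewrite andbF; apply/esym/negbTE/negP => /mem_take.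
    by rewrite mem_enum inE (negbTE nk) andbF.
  rewrite cardsE; have /card_uniqP-> := take_uniq n (enum_uniq (cls F k)).
  by rewrite size_takel // -cardE; apply: cn.
- by move=> v; apply: le_trans (db v); rewrite ler_nat deg_sub.
- by move=> k v; apply: le_trans (cd k v); rewrite ler_nat deg_sub ?cls_sub.
Qed.

Lemma card_conflicts F A (n : nat) (b Dl : R) (X : {set {set T}}) :
  config F A n b Dl -> X \subset F ->
  #|[set j : {set T} * {set T} | (j.1 \in X) &&
       ((j.2 \in F) && ~~ [disjoint j.2 & j.1])]|%:R <= #|X|%:R * (2 * b) :> R.
Proof.
move=> cfg XF.
rewrite -sum1_card natr_sum (eq_bigl (fun j : {set T} * {set T} =>
    (j.1 \in X) && (j.2 \in [set g in F | ~~ [disjoint g & j.1]]))); last first.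
  by move=> j; rewrite !inE.
rewrite -(pair_big_dep (fun f => f \in X)
  (fun f g => g \in [set g in F | ~~ [disjoint g & f]]) (fun _ _ => 1)) /=.
rewrite mulr_natl -sumr_const; apply: ler_sum => f /(subsetP XF) fF.
rewrite sumr_const; apply: le_trans (_ : (\sum_(u in f) deg F u)%:R <= _).
  by rewrite ler_nat; apply: meet_le.
rewrite natr_sum -[2 * b]/(2%:R * b) -(card2 cfg fF) mulr_natl -sumr_const.
by apply: ler_sum => u _; apply: deg_le cfg _.
Qed.

(** Each color picks a uniform edge. A bad event, that two given meeting edges of distinct colors
    are both picked, has probability [n^-2] and shares a color with at most [8 * n * b] bad events,
    so [32 * b <= n] is the local lemma condition. *)
Lemma full_of_dense F A (n : nat) (b Dl : R) :
  config F A n b Dl -> 0 <= b -> (2 <= n)%N -> 32 * b <= n%:R -> full F A.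
Proof.
move=> cfg b0 n2 bn.
have n0 : 0 < n%:R :> R by rewrite ltr0n; apply: leq_trans n2.
have empty k : k \notin A -> cls F k = set0.
  move=> kA; apply/setP => f; rewrite [RHS]inE; apply/negbTE/negP => /clsP[fF].
  by move=> fk; rewrite -fk (col_in cfg fF) in kA.
have n0' : (n%:R)^-1 * n%:R = 1 :> R by rewrite mulVf ?gt_eqF.
pose q (k : K) : R := n%:R^-1.
have q0 k : 0 <= q k by rewrite invr_ge0 ltW.
have q1 k : q k * #|cls F k|%:R <= 1.
  case: (boolP (k \in A)) => kA; last by rewrite empty // cards0 mulr0.
  by rewrite (cls_card cfg) // n0'.
pose mu := pick_mu q (cls F) set0.
have mu0 : forall k f, 0 <= mu k f := pick_mu_ge0 set0 q0 q1.
have mu1 : forall k, \sum_f mu k f = 1 := pick_mu_sum1 q (cls F) set0.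
have nset0 k : set0 \notin cls F k.
  by apply/negP => /clsP[/(card2 cfg)]; rewrite cards0.
have muE k f : f \in cls F k -> mu k f = n%:R^-1.
  move=> fk; rewrite /mu /pick_mu fk mulr1.
  case: eqP fk => [->|_ _]; last by rewrite mulr0 addr0.
  by rewrite (negbTE (nset0 k)).
pose confl (j : {set T} * {set T}) := [&& j.1 \in F, j.2 \in F,
  col j.1 != col j.2 & ~~ [disjoint j.2 & j.1]].
pose bad j (w : {ffun K -> {set T}}) :=
  [&& confl j, w (col j.1) == j.1 & w (col j.2) == j.2].
pose S j := if confl j then [set col j.1; col j.2] else set0.
pose w0 : {ffun K -> {set T}} := [ffun=> set0].
have bad_local j i : i \notin S j -> indep i (bad j).
  rewrite /bad /S; case: (confl j) => // iS w x; rewrite /= !updE.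
  by move: iS; rewrite !inE negb_or => /andP[]; rewrite ![i == _]eq_sym;
    move=> /negbTE-> /negbTE->.
have bad_prob j : avgs mu (enum K) (fun w => (bad j w)%:R) w0 <= n%:R^-1 ^+ 2.
  case: (boolP (confl j)) => cj; last first.
    rewrite (@eq_avgs _ _ _ _ _ _ (fun=> 0)) ?avgs_cst ?exprn_ge0 ?invr_ge0 ?ltW //.
    by move=> w; rewrite /bad (negbTE cj).
  have /and4P[j1 j2 jc _] := cj.
  rewrite (@eq_avgs _ _ _ _ _ _ (fun w => (w (col j.1) == j.1)%:R *
     (w (col j.2) == j.2)%:R)); last first.
    by move=> w; rewrite /bad cj -natrM mulnb.
  have coord f : f \in F ->
      avgs mu (enum K) (fun w => (w (col f) == f)%:R) w0 = n%:R^-1.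
    move=> fF; rewrite (avgs_coord mu1 (fun x => (x == f)%:R)) ?enum_uniq ?mem_enum //.
    rewrite (bigD1 f) //= eqxx mulr1 muE; last by apply/clsP.
    by rewrite big1 ?addr0 // => x /negbTE->; rewrite mulr0.
  rewrite avgs_indepM ?coord ?expr2 // => i _.
  case: (eqVneq (col j.1) i) => [ji|ji]; [right|left] => w x; rewrite updE.
    by rewrite -ji [_ == col j.1]eq_sym (negbTE jc).
  by rewrite (negbTE ji).
have few_dep j : #|[set j' | ~~ [disjoint S j & S j']]|%:R <= 8 * n%:R * b.
  case: (boolP (confl j)) => cj; last first.
    have -> : [set j' | ~~ [disjoint S j & S j']] = set0.
      apply/setP => j'; rewrite [LHS]inE [RHS]inE /S (negbTE cj); apply/negbF.
      by apply/pred0P => x; rewrite /= inE.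
    by rewrite cards0 !mulr_ge0 // ltW.
  (* Conflicts are ordered pairs, so each of the two colors of [j] may be that of the first edge
     ([N]) or of the second ([swap @: N]): four families of size at most [n * (2 * b)]. *)
  pose N k := [set j : {set T} * {set T} | (j.1 \in cls F k) &&
    ((j.2 \in F) && ~~ [disjoint j.2 & j.1])].
  pose swap (j : {set T} * {set T}) := (j.2, j.1).
  have Nle k : k \in A -> #|N k|%:R <= n%:R * (2 * b).
    by move=> kA; rewrite -(cls_card cfg kA); apply: card_conflicts cfg (sub_cls _ _).
  have N'le k : k \in A -> #|swap @: N k|%:R <= n%:R * (2 * b).
    by move=> /Nle; apply: le_trans; rewrite ler_nat leq_imset_card.
  have /and4P[/(col_in cfg) j1 /(col_in cfg) j2 _ _] := cj.
  apply: (@le_trans _ _ (#|N (col j.1)| + #|N (col j.2)| +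
     (#|swap @: N (col j.1)| + #|swap @: N (col j.2)|))%:R); last first.
    rewrite !natrD; have -> : 8 * n%:R * b = n%:R * (2 * b) + n%:R * (2 * b) +
      (n%:R * (2 * b) + n%:R * (2 * b)) by ring.
    by rewrite !lerD ?Nle ?N'le.
  rewrite ler_nat; apply: leq_trans (leq_add (leq_card_setU _ _) (leq_card_setU _ _)).
  apply: leq_trans (leq_card_setU _ _); apply: subset_leq_card.
  apply/subsetP => j'; rewrite inE /S cj; case: ifP => [cj'|_]; last first.
    by case/negP; apply/pred0P => x /=; rewrite in_set0 andbF.
  have /and4P[F1 F2 _ nd] := cj'.
  have mem1 k : col j'.1 = k -> j' \in N k.
    by move=> ck; have jk : j'.1 \in cls F k; [apply/clsP | rewrite inE jk F2 nd].
  have mem2 k : col j'.2 = k -> j' \in swap @: N k.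
    move=> ck; apply/imsetP; exists (swap j'); last by rewrite /swap -surjective_pairing.
    by have jk : j'.2 \in cls F k; [apply/clsP | rewrite inE /= jk F1 disjoint_sym nd].
  case/pred0Pn => x /andP[/=]; rewrite !in_set2 => /orP[]/eqP-> /orP[]/eqP/esym.
  - by move=> /mem1 jN; rewrite !in_setU jN.
  - by move=> /mem2 jN; rewrite !in_setU jN !orbT.
  - by move=> /mem1 jN; rewrite !in_setU jN !orbT.
  - by move=> /mem2 jN; rewrite !in_setU jN !orbT.
have small : 4 * n%:R^-1 ^+ 2 * (8 * n%:R * b) <= 1.
  have -> : 4 * n%:R^-1 ^+ 2 * (8 * n%:R * b) = n%:R^-1 * (n%:R^-1 * n%:R) * (32 * b).
    by ring.
  by rewrite n0' mulr1 ler_pdivrMl ?mulr1.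
have p4 : n%:R^-1 ^+ 2 <= 1 / 4 :> R.
  have n2R : 2 <= n%:R :> R by rewrite (ler_nat R 2 n).
  have : n%:R^-1 * 2 <= n%:R^-1 * n%:R :> R by rewrite ler_wpM2l // invr_ge0 ltW.
  have : 0 <= n%:R^-1 :> R by rewrite invr_ge0 ltW.
  by rewrite n0'; nra.
have [w [wpos wgood]] :=
  local_lemma mu0 mu1 bad_local bad_prob few_dep p4 small.
(* For a color of [A] the null value has no mass, so positive mass forces an edge of the class. *)
have wcls k : k \in A -> w k \in cls F k.
  move=> kA; apply/negP => /negP wk; have := wpos k.
  by rewrite /mu /pick_mu (negbTE wk) mulr0 add0r (cls_card cfg) // n0' subrr mul0r ltxx.
exists w; split=> // k l kA lA kl.
have := wgood (w l, w k); have /clsP[Fk ck] := wcls _ kA; have /clsP[Fl cl] := wcls _ lA.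
rewrite /bad /confl /= Fk Fl ck cl !eqxx !andbT eq_sym kl /= negbK.
by [].
Qed.

End ColoredEdges.

(** * One round of the nibble *)

Section Nibble.
Variables (R : realType) (K T : finType) (col : {set T} -> K).
Variables (F : {set {set T}}) (A : {set K}) (n : nat) (b Dl th dl : R).
Hypothesis cfg : config col F A n b Dl.
Hypothesis n_gt0 : (0 < n)%N.
Hypothesis b_gt0 : 0 < b.
Hypothesis b_le_n : b <= n%:R.
Hypothesis Dl_ge1 : 1 <= Dl.
Hypothesis th_gt0 : 0 < th.
Hypothesis th_le1 : th <= 1.
Hypothesis dl_gt0 : 0 < dl.
Hypothesis dl_le_th : dl <= th.
Hypothesis th2_le_dl : 12 * th ^+ 2 <= dl.

Local Notation I := (K + T)%type.
Local Notation W := {set T}.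
Implicit Types (w : {ffun I -> W}) (i j : I) (k : K) (u v : T) (f x y : W).

(** Proposals of both kinds are vertex sets; a dummy proposal is a singleton. *)
Definition supp i : {set W} :=
  match i with inl k => cls col F k | inr u => [set [set u]] end.

(* The dummy coordinate of a vertex [u] tops up its degree, so that every vertex
   is picked with the same total rate [prate]. *)
Definition rate i : R :=
  match i with
  | inl k => th / n%:R
  | inr u => th * (b - (deg F u)%:R) / n%:R
  end.

Local Notation mu := (pick_mu rate supp set0).

Definition prate : R := th * b / n%:R.

(* Values outside the support are read as no proposal at all, so that the
   dependence on a coordinate is local for every value and not only almost
   surely. *)
Definition pick i x : W := if x \in supp i then x else set0.

Let nR_gt0 : 0 < n%:R :> R. Proof. by rewrite ltr0n. Qed.

Let nV : (n%:R)^-1 * n%:R = 1 :> R.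
Proof. by rewrite mulVf ?gt_eqF. Qed.

Lemma p_ge0 : 0 <= prate.
Proof. by rewrite /prate !mulr_ge0 ?invr_ge0 ?(ltW th_gt0) ?(ltW b_gt0). Qed.

Lemma p_le_th : prate <= th.
Proof.
by rewrite /prate -mulrA ler_piMr ?(ltW th_gt0) // ler_pdivrMr // mul1r.
Qed.

Lemma cls_notin k : k \notin A -> cls col F k = set0.
Proof.
move=> kA; apply/setP => f; rewrite [RHS]inE; apply/negbTE/negP => /clsP[fF fk].
by rewrite -fk (col_in cfg fF) in kA.
Qed.

Lemma rate_ge0 i : 0 <= rate i.
Proof.
case: i => [k|u] /=; rewrite !mulr_ge0 ?invr_ge0 ?(ltW th_gt0) ?(ltW nR_gt0) //.
by rewrite subr_ge0 (deg_le cfg).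
Qed.

Lemma rate_supp_le1 i : rate i * #|supp i|%:R <= 1.
Proof.
case: i => [k|u] /=.
  case: (boolP (k \in A)) => kA; last by rewrite cls_notin // cards0 mulr0.
  by rewrite (cls_card cfg) // -mulrA nV mulr1.
rewrite cards1 mulr1 ler_pdivrMr // mul1r; apply: le_trans b_le_n.
apply: (@le_trans _ _ (1 * (b - (deg F u)%:R))).
  by rewrite ler_wpM2r // subr_ge0 (deg_le cfg).
by rewrite mul1r lerBlDr lerDl.
Qed.

Lemma mu_ge0 i x : 0 <= mu i x.
Proof. exact: pick_mu_ge0 rate_ge0 rate_supp_le1 i x. Qed.

Lemma mu_sum1 i : \sum_x mu i x = 1.
Proof. exact: pick_mu_sum1. Qed.

Lemma set0_notin_supp i : set0 \notin supp i.
Proof.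
apply/negP; case: i => [k|u] /=; last first.
  by rewrite inE => /eqP/setP/(_ u); rewrite !inE eqxx.
by case/clsP => /(card2 cfg); rewrite cards0.
Qed.

Lemma pick0 i : pick i set0 = set0.
Proof. by rewrite /pick if_same. Qed.

Lemma pick_supp i x : x \in supp i -> pick i x = x.
Proof. by rewrite /pick => ->. Qed.

Lemma pick_neq0 i x : pick i x != set0 -> x \in supp i /\ pick i x = x.
Proof. by rewrite /pick; case: ifP => //; rewrite eqxx. Qed.

Lemma mean_pick i (G : W -> R) : G set0 = 0 ->
  \sum_x mu i x * G (pick i x) = rate i * \sum_(x in supp i) G x.
Proof.
move=> G0; rewrite (pick_muE rate supp set0 i (fun x => G (pick i x))) pick0 G0.
by rewrite mulr0 addr0; congr (_ * _); apply: eq_bigr => x /pick_supp->.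
Qed.

Lemma card_pick i x : (#|pick i x| <= 2)%N.
Proof.
rewrite /pick; case: ifP => [|_]; last by rewrite cards0.
case: i => [k|u] /=; first by case/clsP => /(card2 cfg)->.
by rewrite inE => /eqP->; rewrite cards1.
Qed.

(** The probability that the proposal of [i] covers [u], since each element of [supp i] has mass
    [rate i]. *)
Definition vrate i u : R := rate i * (\sum_(x in supp i) (u \in x)%:R).

Lemma cdegE k u : (deg (cls col F k) u)%:R = \sum_(x in cls col F k) (u \in x)%:R :> R.
Proof.
rewrite /deg -natr_sum; congr (_%:R); rewrite -sum1_card big_mkcond [RHS]big_mkcond.
by apply: eq_bigr => f _; rewrite inE; case: (f \in _); case: (u \in f).
Qed.

Lemma sum_vrate u : \sum_i vrate i u = prate.
Proof.
rewrite big_sumType /= /vrate /=.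
rewrite (eq_bigr (fun k => th / n%:R * (deg (cls col F k) u)%:R)); last first.
  by move=> k _; rewrite cdegE.
rewrite -mulr_sumr -natr_sum sum_cdeg (bigD1 u) //= big_set1 inE eqxx mulr1.
rewrite big1 => [|v vu]; last by rewrite big_set1 inE eq_sym (negbTE vu) mulr0.
by rewrite /prate; ring.
Qed.

(** * Edges that a class loses to the proposals *)

Definition class_hits k (X : W) : nat :=
  #|[set f in cls col F k | ~~ [disjoint f & X]]|.

Lemma class_hits_le k (X : W) :
  (class_hits k X)%:R <= \sum_(f in cls col F k) \sum_(u in f) (u \in X)%:R :> R.
Proof.
rewrite /class_hits -sum1_card natr_sum big_mkcond [leRHS]big_mkcond /=.
apply: ler_sum => f _; rewrite inE; case: (f \in _) => //=.
case: (boolP [disjoint f & X]) => //= [_|/pred0Pn[u /= /andP[uf uX]]].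
  exact: sumr_ge0.
by rewrite (bigD1 u) //= uX lerDl sumr_ge0.
Qed.

(** Hits are counted proposal by proposal, with multiplicity: an upper bound on the edges hit that
    is a sum fit for [seq_upper_tail]. *)
Definition bad_class k w : bool :=
  (k \in A) && ((2 * prate + dl) * n%:R
                 <= \sum_(i <- enum {: I}) (class_hits k (pick i (w i)))%:R).

(** The exponent common to the three tail bounds; [bad_class_prob] dictates it and the other two
    have room. *)
Definition decay : R := dl ^+ 2 * b / (32 * th * Dl).

Lemma bad_class_prob k w :
  avgs mu (enum {: I}) (fun w => (bad_class k w)%:R) w <= expR (- decay).
Proof.
case: (boolP (k \in A)) => kA; last first.
  rewrite (@eq_avgs _ _ _ _ _ _ (fun=> 0)); last first.
    by move=> w'; rewrite /bad_class (negbTE kA).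
  by rewrite avgs_cst ?expR_ge0 //; apply: mu_sum1.
(* A proposal covers at most two vertices, each on at most [Dl] edges of the class, hence [c]. With
   this [lam] the second-order term takes at most half of the slack [lam * (dl * n%:R)]. *)
pose lam := dl / (16 * th * Dl); pose c := 2 * Dl.
pose m i : R := \sum_(f in cls col F k) \sum_(u in f) vrate i u.
have Dl0 : 0 < Dl by apply: lt_le_trans Dl_ge1.
have lamc : lam * c = dl / (8 * th).
  by rewrite /lam /c; field; rewrite !gt_eqF.
have dth : dl / th <= 1 by rewrite ler_pdivrMr // mul1r.
have lamc' : lam * c = dl / th / 8 by rewrite lamc; field; rewrite gt_eqF.
have summ : \sum_(i <- enum {: I}) m i = 2 * prate * n%:R.
  rewrite big_enum /= exchange_big /= (eq_bigr (fun=> 2 * prate)) => [|f /clsP[fF _]].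
    by rewrite sumr_const (cls_card cfg) // mulr_natr.
  rewrite exchange_big /= (eq_bigr (fun=> prate)) => [|u _]; last exact: sum_vrate.
  by rewrite sumr_const (card2 cfg) // mulr_natl.
have lam0 : 0 <= lam.
  by rewrite /lam !mulr_ge0 ?invr_ge0 ?mulr_ge0 ?(ltW dl_gt0) ?(ltW th_gt0) ?(ltW Dl0).
have := @seq_upper_tail _ _ _ mu mu_ge0 mu_sum1 (enum {: I})
  (fun i w => (class_hits k (pick i (w i)))%:R) m c lam ((2 * prate + dl) * n%:R) w.
rewrite summ => tail.
rewrite (@eq_avgs _ _ _ _ _ _ (fun w => ((2 * prate + dl) * n%:R <=
   \sum_(i <- enum {: I}) (class_hits k (pick i (w i)))%:R)%R%:R)); last first.
  by move=> w'; rewrite /bad_class kA.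
apply: le_trans (tail _ lam0 _ _ _) _.
- move=> i w'; rewrite ler0n /=.
  apply: le_trans (_ : (\sum_(u in pick i (w' i)) deg (cls col F k) u)%:R <= _).
    by rewrite ler_nat; apply: meet_le.
  rewrite natr_sum; apply: (@le_trans _ _ (\sum_(u in pick i (w' i)) Dl)).
    by apply: ler_sum => u _; apply: cdeg_le cfg _ _.
  by rewrite sumr_const -mulr_natl ler_wpM2r ?(ltW Dl0) // ler_nat card_pick.
- by rewrite lamc'; lra.
- move=> s1 i s2 sE j js w' x; rewrite updE; case: eqP => // ij.
  have := enum_uniq {: I}; rewrite sE ij cat_uniq /= => /and3P[_ _ /andP[]].
  by rewrite js.
- move=> i w'.
  rewrite /avg (eq_bigr (fun x => mu i x * (class_hits k (pick i x))%:R)); last first.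
    by move=> x _; rewrite updE eqxx.
  rewrite (mean_pick i (G := fun x => (class_hits k x)%:R)); last first.
    rewrite /class_hits; apply/eqP; rewrite pnatr_eq0 cards_eq0 -subset0.
    apply/subsetP => f; rewrite inE => /andP[_ /pred0Pn[u /=]].
    by rewrite in_set0 andbF.
  have -> : m i = rate i * \sum_(x in supp i)
      \sum_(f in cls col F k) \sum_(u in f) (u \in x)%:R.
    rewrite exchange_big mulr_sumr; apply: eq_bigr => f _.
    by rewrite exchange_big mulr_sumr; apply: eq_bigr.
  by rewrite ler_wpM2l ?rate_ge0 // ler_sum // => x _; apply: class_hits_le.
rewrite ler_expR lamc'.
have ple := p_le_th; have p0 := p_ge0.
have -> : - decay = - (lam * (dl / 2) * b).
  by rewrite /decay /lam; field; rewrite !gt_eqF.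
have key : prate * (dl / th) <= dl.
  by rewrite mulrCA -[leRHS]mulr1 ler_wpM2l ?(ltW dl_gt0) // ler_pdivrMr // mul1r.
have : lam * ((dl / 2) * b) <= lam * ((dl / 2) * n%:R).
  by rewrite !ler_wpM2l // divr_ge0 ?(ltW dl_gt0).
have : lam * (prate * (dl / th) * n%:R) <= lam * (dl * n%:R).
  by rewrite ler_wpM2l // ler_wpM2r // ltW.
move: (dl / th) => z; nra.
Qed.


(** * Survival of the edges at a vertex *)

Definition star v : {set W} := [set f in F | v \in f].

(** The vertex [v] is removed from [f]: otherwise a proposal covering [v] would hit all of [star v]
    at once, and the bound of [card_hit] would be lost. *)
Definition hit v i (x : W) : {set W} :=
  [set f in star v | (if i is inl k then (col f == k) && (x != set0) else false)
     || ~~ [disjoint f :\ v & x]].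

Definition spick v i x := hit v i (pick i x).

Lemma other_end v f : f \in star v -> exists2 u, u != v & f = [set v; u].
Proof.
rewrite inE => /andP[/(card2 cfg) f2 vf].
have : (0 < #|f :\ v|)%N by rewrite -(ltn_add2l (v \in f)) -cardsD1 f2 vf.
rewrite card_gt0 => /set0Pn[u]; rewrite !inE => /andP[uv uf]; exists u => //.
apply/eqP; rewrite eq_sym eqEcard f2 cards2 eq_sym uv andbT.
by apply/subsetP => y; rewrite !inE => /orP[]/eqP->.
Qed.

Lemma setD1_edge v u : u != v -> [set v; u] :\ v = [set u].
Proof.
move=> uv; apply/setP => y; rewrite !inE; case: (eqVneq y v) => [->|] //=.
by rewrite eq_sym (negbTE uv).
Qed.

Lemma hit_set0 v i : hit v i set0 = set0.
Proof.
apply/setP => f; rewrite [RHS]inE; apply/negbTE/negP; rewrite inE => /andP[_].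
have -> : [disjoint f :\ v & set0] by apply/pred0P => y /=; rewrite in_set0 andbF.
by rewrite orbF; case: i => // k; rewrite eqxx andbF.
Qed.

Lemma card_hit v i x : #|star v :&: spick v i x|%:R <= 3 * Dl.
Proof.
pose B := [set [set v; u] | u in pick i x].
pose C := if i is inl k then [set f in cls col F k | v \in f] else set0.
have sub : star v :&: spick v i x \subset C :|: B.
  apply/subsetP => f; rewrite in_setI => /andP[fv]; rewrite inE fv /= in_setU.
  case/orP => [|/pred0Pn[y /= /andP[yf yx]]]; last first.
    apply/orP; right; have [u uv fE] := other_end fv.
    move: yf; rewrite fE setD1_edge // inE => /eqP yu.
    by rewrite -yu; apply/imsetP; exists y.
  rewrite /C; case: (i) => // k /andP[ck _].
  by move: fv; rewrite !inE ck andbT => ->.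
have leB : #|B|%:R <= 2 * Dl.
  apply: (@le_trans _ _ 2%:R); last by rewrite ler_peMr.
  by rewrite ler_nat; apply: leq_trans (leq_imset_card _ _) (card_pick _ _).
have leC : #|C|%:R <= Dl.
  rewrite /C; case: (i) => [k|u]; first exact: (cdeg_le cfg).
  by rewrite cards0; apply: le_trans Dl_ge1.
apply: (@le_trans _ _ (#|C|%:R + #|B|%:R)); last by lra.
rewrite -natrD ler_nat; apply: leq_trans (subset_leq_card sub) _.
exact: leq_card_setU.
Qed.

Lemma hit_probE v i f :
  hit_prob mu (spick v) i f = rate i * \sum_(x in supp i) (f \in hit v i x)%:R.
Proof.
rewrite /hit_prob /spick (mean_pick i (G := fun x => (f \in hit v i x)%:R)) //.
by rewrite hit_set0 in_set0.
Qed.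

Definition hit_rate : R := th + prate - th * Dl / n%:R.

(** The color of [f] proposes with probability [th], and the other end is proposed at total rate
    [prate]. A proposal of that color covering that end would count twice; this costs at most
    [th * Dl / n%:R]. *)
Lemma sum_hit_prob v f : f \in star v ->
  hit_rate <= \sum_(i <- enum {: I}) hit_prob mu (spick v) i f.
Proof.
move=> fv; have [u uv fE] := other_end fv.
have fF : f \in F by move: fv; rewrite inE => /andP[].
have vle i : vrate i u <= hit_prob mu (spick v) i f.
  rewrite hit_probE ler_wpM2l ?rate_ge0 // ler_sum // => x _.
  case: (boolP (u \in x)) => ux; last exact: ler0n.
  suff -> : f \in hit v i x by [].
  rewrite inE fv /=; apply/orP; right; apply/pred0Pn; exists u => /=.
  by rewrite ux andbT fE setD1_edge // inE.
have own : hit_prob mu (spick v) (inl (col f)) f = th.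
  rewrite hit_probE /= (eq_bigr (fun=> 1)) => [|x xc].
    by rewrite sumr_const (cls_card cfg) ?(col_in cfg) // -mulrA nV mulr1.
  rewrite inE fv eqxx /=; suff -> : x != set0 by [].
  by apply: contraTneq xc => ->; apply: (set0_notin_supp (inl _)).
have own_v : vrate (inl (col f)) u <= th * Dl / n%:R.
  rewrite /vrate /= -cdegE mulrAC ler_wpM2r ?invr_ge0 ?(ltW nR_gt0) //.
  by rewrite ler_wpM2l ?(ltW th_gt0) // (cdeg_le cfg).
rewrite big_enum /= (bigD1 (inl (col f))) //= own.
have := sum_vrate u; rewrite (bigD1 (inl (col f))) //= => pE.
apply: (@le_trans _ _ (th + \sum_(i | i != inl (col f)) vrate i u)).
  by rewrite /hit_rate; lra.
by rewrite lerD2l ler_sum.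
Qed.

Definition survivors v w : {set W} := unhit (spick v) (enum {: I}) (star v) w.

(** The factor [1 - lam * c] of [unhit_expR] for the [lam] and [c] chosen in [bad_star_prob]. *)
Definition kap : R := 1 - dl / (2 * th).

Definition bad_star v w : bool :=
  (1 + dl) * b <= #|survivors v w|%:R * (1 + kap * hit_rate).

(** By [sum_hit_prob] each survivor weighs at least [1 + kap * hit_rate] in [unhit_expR], whose
    bound is at most exp([lam * b]); the exponential Markov inequality then leaves
    exp(-[lam * (dl * b)]). *)
Lemma bad_star_prob v w :
  avgs mu (enum {: I}) (fun w => (bad_star v w)%:R) w <= expR (- decay).
Proof.
have Dl0 : 0 < Dl by apply: lt_le_trans Dl_ge1.
pose lam := dl / (6 * th * Dl); pose c := 3 * Dl.
have lamc : lam * c = dl / (2 * th) by rewrite /lam /c; field; rewrite !gt_eqF.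
have lam0 : 0 <= lam by rewrite /lam divr_ge0 ?mulr_ge0 ?(ltW dl_gt0) ?(ltW th_gt0) ?(ltW Dl0).
have kapE : 1 - lam * c = kap by rewrite lamc.
have kap0 : 0 <= kap.
  rewrite subr_ge0 ler_pdivrMr ?mulr_gt0 // mul1r; move: dl_le_th th_gt0; lra.
have lamc1 : lam * c <= 1 by rewrite -subr_ge0 kapE.
apply: le_trans (markov_expR mu_ge0 (enum {: I})
  (fun w => #|survivors v w|%:R * (1 + kap * hit_rate)) ((1 + dl) * b) w lam0) _.
apply: (@le_trans _ _ (expR (- (lam * ((1 + dl) * b))) * expR (lam * b))); last first.
  rewrite -expRD ler_expR.
  have -> : decay = lam * (dl * b) * (3 / 16) by rewrite /decay /lam; field; rewrite !gt_eqF.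
  have := mulr_ge0 lam0 (mulr_ge0 (ltW dl_gt0) (ltW b_gt0)).
  have -> : lam * ((1 + dl) * b) = lam * b + lam * (dl * b) by ring.
  by move: (lam * b) (lam * (dl * b)) => y z; lra.
rewrite ler_wpM2l ?expR_ge0 //.
have cle i x : #|star v :&: spick v i x|%:R <= c by apply: card_hit.
apply: le_trans (le_trans (unhit_expR mu_ge0 mu_sum1 w (enum_uniq {: I}) lam0 lamc1 cle) _).
  apply: le_avgs => [|w']; first exact: mu_ge0.
  rewrite ler_expR ler_wpM2l // kapE mulr_natl -sumr_const ler_sum // => f.
  rewrite inE => /andP[fv _].
  by rewrite lerD2l ler_wpM2l // sum_hit_prob.
by rewrite ler_expR ler_wpM2l // (deg_le cfg).
Qed.


(** * Proposals that fail *)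

Definition before j i : bool := (index j (enum {: I}) < index i (enum {: I}))%N.

Definition occupied i w : W := \bigcup_(j | before j i) pick j (w j).

Definition fails k w : bool :=
  (pick (inl k) (w (inl k)) != set0) &&
  ~~ [disjoint pick (inl k) (w (inl k)) & occupied (inl k) w].

(* The truncation bounds the conditional mean given any past; it is void as soon
   as no class is bad. *)
Definition fail_weight v i w : R :=
  if i is inl k then
    (deg (cls col F k) v)%:R * (fails k w &&
      ((class_hits k (occupied (inl k) w))%:R <= (2 * prate + dl) * n%:R)%R)%:R
  else 0.

Definition bad_fail v w : bool :=
  dl * b <= \sum_(i <- enum {: I}) fail_weight v i w.

Lemma disjoint_occupied (X : W) i w : [disjoint X & occupied i w] =
  [forall (j | before j i), [disjoint X & pick j (w j)]].
Proof.
apply/idP/forall_inP => [dX j ji | dX].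
  apply: disjointWr dX; exact: (bigcup_sup j).
apply/pred0P => y /=; apply/negbTE/negP => /andP[yX /bigcupP[j ji yj]].
by have /pred0P/(_ y) := dX j ji; rewrite /= yX yj.
Qed.

Lemma occupied_upd i j w x : ~~ before j i -> occupied i (upd w j x) = occupied i w.
Proof.
move=> ji; apply: eq_bigr => l li; rewrite updE.
by case: eqP li => // ->; rewrite (negbTE ji).
Qed.

(** [occupied] depends on earlier coordinates only, so it stays fixed while [i] is averaged. Each
    class edge meeting it is proposed with mass [th / n%:R], and the truncation bounds their
    number. *)
Lemma fail_weight_mean v i w :
  avg mu i (fail_weight v i) w <=
    (if i is inl k then (deg (cls col F k) v)%:R else 0) * (th * (2 * prate + dl)).
Proof.
case: i => [k|u]; last first.
  by rewrite mul0r /avg big1 // => x _; rewrite mulr0.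
set O := occupied (inl k) w; set d := (deg _ v)%:R.
have p0 := p_ge0.
pose G x : R := d * ((x != set0) && ~~ [disjoint x & O] &&
  ((class_hits k O)%:R <= (2 * prate + dl) * n%:R)%R)%:R.
rewrite /avg (eq_bigr (fun x => mu (inl k) x * G (pick (inl k) x))); last first.
  move=> x _; rewrite /fail_weight /fails occupied_upd ?updE ?eqxx //.
  by rewrite /before ltnn.
rewrite mean_pick; last by rewrite /G eqxx mulr0.
rewrite -mulr_sumr mulrCA ler_wpM2l //=.
case: (leP (class_hits k O)%:R ((2 * prate + dl) * n%:R)) => hO; last first.
  rewrite big1 ?mulr0 => [|x _]; last by rewrite andbF.
  by rewrite mulr_ge0 ?(ltW th_gt0) // addr_ge0 ?(ltW dl_gt0) // mulr_ge0.
apply: (@le_trans _ _ (th / n%:R * (class_hits k O)%:R)); last first.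
  rewrite -mulrA ler_wpM2l ?(ltW th_gt0) // mulrC ler_pdivrMr //.
rewrite ler_wpM2l ?divr_ge0 ?(ltW th_gt0) ?(ltW nR_gt0) //.
rewrite -natr_sum ler_nat /class_hits -sum1_card big_mkcond [leqRHS]big_mkcond /=.
apply: leq_sum => x _; rewrite [in leqRHS]inE; case: (x \in cls col F k) => //=.
by rewrite andbT; case: (x != set0); case: [disjoint x & O].
Qed.

Lemma bad_fail_prob v w :
  avgs mu (enum {: I}) (fun w => (bad_fail v w)%:R) w <= expR (- decay).
Proof.
have Dl0 : 0 < Dl by apply: lt_le_trans Dl_ge1.
(* The largest value [seq_upper_tail] allows. It doubles a mean that is at most [b * (dl / 4)], so
   half of the slack [lam * (dl * b)] remains. *)
pose lam := 1 / (2 * Dl).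
have lamc : lam * Dl = 1 / 2 by rewrite /lam; field; rewrite gt_eqF.
have lam0 : 0 <= lam by rewrite divr_ge0 // mulr_ge0 // ltW.
have p0 := p_ge0; have ple := p_le_th.
have tail := @seq_upper_tail _ _ _ mu mu_ge0 mu_sum1 (enum {: I})
  (fail_weight v) (fun i => (if i is inl k then (deg (cls col F k) v)%:R else 0)
     * (th * (2 * prate + dl))) Dl lam (dl * b) w.
apply: le_trans (tail _ lam0 _ _ (fail_weight_mean v)) _ => {tail}.
- move=> [k|u] w' /=; last by rewrite lexx ltW.
  rewrite mulr_ge0 //=; apply: le_trans (cdeg_le cfg k v).
  by rewrite ler_piMr // lern1 leq_b1.
- by rewrite lamc.
- move=> s1 i s2 sE j js w' x.
  have nji : ~~ before j i.
    have := enum_uniq {: I}; rewrite /before sE cat_uniq /= => /and3P[_ hs /andP[is2 _]].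
    have is1 : i \notin s1 by apply: contra hs => is1; rewrite is1.
    have js1 : j \notin s1.
      by apply: contra hs => js1; apply/orP; right; apply/hasP; exists j.
    rewrite !index_cat (negbTE is1) (negbTE js1) /= eqxx addn0 -leqNgt.
    exact: leq_addr.
  have ji : i != j.
    have := enum_uniq {: I}; rewrite sE cat_uniq /= => /and3P[_ _ /andP[is2 _]].
    by apply: contraNneq is2 => ->.
  case: i {sE} nji ji => [k|u] nji ji //=.
  by rewrite /fails occupied_upd // updE (negbTE ji).
have sumd : \sum_(i <- enum {: I}) (if i is inl k then (deg (cls col F k) v)%:R else 0)
    = (deg F v)%:R :> R.
  by rewrite big_enum big_sumType /= [X in _ + X]big1 // addr0 -natr_sum sum_cdeg.
rewrite lamc -mulr_suml sumd ler_expR.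
set d : R := (deg F v)%:R; have db : d <= b by apply: (deg_le cfg).
have small : th * (2 * prate + dl) <= dl / 4.
  have : th * (2 * prate + dl) <= th * (3 * th).
    by rewrite ler_wpM2l ?(ltW th_gt0) //; move: dl_le_th; lra.
  by move: th2_le_dl; nra.
have small2 : d * (th * (2 * prate + dl)) <= b * (dl / 4).
  by rewrite ler_pM // !mulr_ge0 ?(ltW th_gt0) // addr_ge0 ?(ltW dl_gt0) // mulr_ge0.
have LamE : decay = lam * (dl * b) * (dl / th) / 16.
  by rewrite /decay /lam; field; rewrite !gt_eqF.
have : lam * (dl * b) * (dl / th) <= lam * (dl * b).
  rewrite ler_piMr // ?(mulr_ge0 lam0 (mulr_ge0 (ltW dl_gt0) (ltW b_gt0))) //.
  by rewrite ler_pdivrMr // mul1r.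
have h0 := mulr_ge0 lam0 (mulr_ge0 (ltW dl_gt0) (ltW b_gt0)).
have : lam * (d * (th * (2 * prate + dl))) <= lam * (b * (dl / 4)) by rewrite ler_wpM2l.
have -> : lam * (b * (dl / 4)) = lam * (dl * b) / 4 by ring.
rewrite {}LamE.
have -> : lam * (1 + 2 * (1 / 2)) * (d * (th * (2 * prate + dl)))
  = 2 * (lam * (d * (th * (2 * prate + dl)))) by field.
move: (lam * (d * _)) h0; move: (lam * (dl * b)) => y z.
move: (y * (dl / th)) => t; lra.
Qed.


(** * Which coordinates a bad event depends on *)

Definition touch i j : bool :=
  (i == j) || ~~ [disjoint cover (supp i) & cover (supp j)].

Lemma pick_sub i x : pick i x \subset cover (supp i).
Proof.
rewrite /pick; case: ifP => [xi|_]; last exact: sub0set.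
exact: bigcup_sup xi.
Qed.

Lemma no_touch i j f x : ~~ touch i j -> f \in supp i -> [disjoint f & pick j x].
Proof.
rewrite negb_or negbK => /andP[_ dij] fi.
apply: disjointWl (bigcup_sup _ fi) _; apply: disjointWr (pick_sub _ _) dij.
Qed.

Lemma touch_vertex v k f : f \in cls col F k -> v \in f -> touch (inr v) (inl k).
Proof.
move=> fk vf; rewrite /touch /=; apply/pred0Pn; exists v => /=.
rewrite /cover big_set1 inE eqxx /=; apply/bigcupP; by exists f.
Qed.

Lemma class_hits_eq0 k i x : ~~ touch (inl k) i -> class_hits k (pick i x) = 0%N.
Proof.
move=> ki; apply/eqP; rewrite cards_eq0 -subset0; apply/subsetP => f.
by rewrite inE => /andP[fk]; rewrite (no_touch _ ki).
Qed.

Lemma bad_class_local k j : ~~ touch (inl k) j -> indep j (bad_class k).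
Proof.
move=> kj w x; rewrite /bad_class; congr (_ && (_ <= _)).
apply: eq_bigr => i _; rewrite updE; case: eqP => // ->.
by rewrite !class_hits_eq0.
Qed.

Section StarLocal.
Variables (v : T) (j : I).
Hypothesis far : forall i, touch (inr v) i -> ~~ touch i j.

(** An edge at [v] can be hit only by a coordinate that touches its color, and that color touches
    [inr v]: the event depends on coordinates within two steps of [touch]. *)
Lemma bad_star_local : indep j (bad_star v).
Proof.
move=> w x; rewrite /bad_star; congr (_ <= _%:R * _).
apply: eq_card => f; rewrite [LHS]inE [RHS]inE.
case: (boolP (f \in star v)) => //= fv; apply: eq_all => i /=.
rewrite updE; case: eqP => // ->.
have [fF vf] : f \in F /\ v \in f by move: fv; rewrite inE => /andP[].
have fk : f \in cls col F (col f) by apply/clsP.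
have nt := far (touch_vertex fk vf).
have nohit y : f \notin spick v j y.
  rewrite inE fv /= negb_or; apply/andP; split; last first.
    rewrite negbK; apply: disjointWl (no_touch y nt fk); exact: subsetDl.
  case: (j) nt => // k; rewrite /touch; case: eqP => //= ck.
  by move=> _; apply/nandP; left; apply/eqP => ckk; case: ck; rewrite ckk.
by rewrite !nohit.
Qed.

Lemma bad_fail_local : indep j (bad_fail v).
Proof.
move=> w x; rewrite /bad_fail; congr (_ <= _); apply: eq_bigr => i _.
case: i => // k; rewrite /fail_weight.
have [->|] := eqVneq (deg (cls col F k) v) 0%N; first by rewrite !mul0r.
rewrite cards_eq0 => /set0Pn[f]; rewrite inE => /andP[fk vf].
have nt := far (touch_vertex fk vf).
have dis g : g \in cls col F k ->
    [disjoint g & occupied (inl k) (upd w j x)] = [disjoint g & occupied (inl k) w].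
  move=> gk; rewrite !disjoint_occupied; apply: eq_forallb => i.
  by rewrite updE; case: eqP => // ->; rewrite !(no_touch _ nt).
have kj : inl k != j by move: nt; rewrite negb_or => /andP[].
congr (_ * (_ && _)%:R).
  rewrite /fails updE (negbTE kj); case: (boolP (_ == set0)) => //= /pick_neq0[wk ->].
  by rewrite dis.
congr (_%:R <= _); apply: eq_card => g; rewrite [LHS]inE [RHS]inE.
by case: (boolP (g \in cls col F k)) => // /dis->.
Qed.

End StarLocal.

Lemma touch_sym i j : touch i j = touch j i.
Proof. by rewrite /touch eq_sym disjoint_sym. Qed.

Lemma card_cover_supp i : (#|cover (supp i)| <= 2 * n)%N.
Proof.
case: i => [k|u] /=; last first.
  by rewrite /cover big_set1 cards1; apply: leq_trans (_ : 2 <= _)%N => //; rewrite leq_pmulr.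
apply: leq_trans (leq_card_cover _) _.
rewrite (eq_bigr (fun=> 2%N)) => [|f /clsP[/(card2 cfg)]] //.
rewrite sum_nat_const mulnC leq_mul2l /=.
case: (boolP (k \in A)) => kA; first by rewrite (cls_card cfg).
by rewrite cls_notin // cards0.
Qed.

(** Apart from [i] itself, a touching coordinate is found at one of at most [2 * n] vertices, as its
    dummy or as the color of one of its at most [B] edges. *)
Lemma card_touch (B : nat) i : (forall u, deg F u <= B)%N ->
  (#|[set j | touch i j]| <= 1 + 2 * n * (1 + B))%N.
Proof.
move=> dB; pose N u : {set I} := inr u |: [set inl (col f) | f in star u].
have cN u : (#|N u| <= 1 + B)%N.
  apply: leq_trans (leq_card_setU _ _) _; rewrite cards1 leq_add2l.
  by apply: leq_trans (leq_imset_card _ _) (dB u).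
have sub : [set j | touch i j] \subset i |: \bigcup_(u in cover (supp i)) N u.
  apply/subsetP => j; rewrite inE in_setU1 eq_sym => /orP[->//|].
  move=> /pred0Pn[u /= /andP[ui uj]]; apply/orP; right; apply/bigcupP; exists u => //.
  case: j uj => [k|y] /= /bigcupP[f].
    move=> /clsP[fF fk] uf; rewrite in_setU1; apply/orP; right.
    by apply/imsetP; exists f; rewrite ?fk // inE fF.
  by rewrite inE => /eqP->; rewrite inE => /eqP->; rewrite in_setU1 eqxx.
apply: leq_trans (subset_leq_card sub) _.
apply: leq_trans (leq_card_setU _ _) _; rewrite cards1 leq_add2l.
apply: leq_trans (_ : \sum_(u in cover (supp i)) (1 + B) <= _)%N; last first.
  by rewrite sum_nat_const leq_mul2r card_cover_supp orbT.
elim/big_ind2: _ => [||u _]; [by rewrite cards0 | | exact: cN].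
move=> X a Y c Xa Yc; apply: leq_trans (leq_card_setU _ _) _; exact: leq_add.
Qed.

Definition bad j w : bool :=
  match j with inl k => bad_class k w | inr v => bad_star v w || bad_fail v w end.

Lemma bad_prob j w : avgs mu (enum {: I}) (fun w => (bad j w)%:R) w <= 2 * expR (- decay).
Proof.
have e0 := expR_ge0 (- decay).
case: j => [k|v] /=; first by apply: le_trans (bad_class_prob k w) _; lra.
apply: (@le_trans _ _ (avgs mu (enum {: I}) (fun w =>
    (bad_star v w)%:R + (bad_fail v w)%:R) w)).
  apply: le_avgs => [|w']; first exact: mu_ge0.
  by case: (bad_star v w'); case: (bad_fail v w') => /=; lra.
rewrite avgsD; have := bad_star_prob v w; have := bad_fail_prob v w; lra.
Qed.

(** Dependence sets have radius two for [touch], so events whose sets meet are within four steps,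
    hence the fourth power. The 8 is the 4 of the local lemma times the 2 of [bad_prob]. *)
Lemma good_picks (B : nat) : (forall u, deg F u <= B)%N ->
  8 * ((1 + 2 * n * (1 + B)) ^ 4)%N%:R * expR (- decay) <= 1 ->
  exists w, forall j, ~~ bad j w.
Proof.
move=> dB small; set D := (1 + 2 * n * (1 + B))%N in small.
pose nbh (X : {set I}) := \bigcup_(i in X) [set j | touch i j].
have nbh_card X : (#|nbh X| <= #|X| * D)%N.
  rewrite -sum_nat_const; apply: leq_trans (_ : \sum_(i in X) #|[set j | touch i j]| <= _)%N.
    rewrite /nbh; elim/big_ind2: _ => [||//]; first by rewrite cards0.
    by move=> Y a Z c Ya Zc; apply: leq_trans (leq_card_setU _ _) _; apply: leq_add.
  by apply: leq_sum => i _; apply: card_touch.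
pose S i := nbh (nbh [set i]).
have inS i l j : touch i l -> touch l j -> j \in S i.
  move=> il lj; apply/bigcupP; exists l; rewrite ?inE //.
  by apply/bigcupP; exists i; rewrite ?inE.
(* The equality clause of [touch] matters here: a color outside [A] has empty support, whose cover
   is disjoint from itself. *)
have refl i : touch i i by rewrite /touch eqxx.
have loc j i : i \notin S j -> indep i (bad j).
  move=> iS; have far l : touch j l -> ~~ touch l i.
    by move=> jl; apply: contra iS; apply: inS.
  case: j iS far => [k|v] iS far.
    by apply: bad_class_local; apply: far.
  by move=> w x; rewrite /bad bad_star_local // bad_fail_local.
have e0 := expR_ge0 (- decay).
have D0 : (0 < D ^ 4)%N by rewrite expn_gt0.
have few j : #|[set j' | ~~ [disjoint S j & S j']]|%:R <= (D ^ 4)%N%:R :> R.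
  rewrite ler_nat; apply: leq_trans (_ : #|nbh (nbh (S j))| <= _)%N.
    apply: subset_leq_card; apply/subsetP => j'; rewrite inE => /pred0Pn[i /= /andP[ij]].
    move=> /bigcupP[l /bigcupP[l' /set1P->]]; rewrite !in_set => j'l li.
    apply/bigcupP; exists l; last by rewrite inE touch_sym.
    by apply/bigcupP; exists i => //; rewrite inE touch_sym.
  rewrite !expnS expn0 muln1 !mulnA.
  apply: leq_trans (nbh_card _) _; rewrite leq_mul2r; apply/orP; right.
  apply: leq_trans (nbh_card _) _; rewrite leq_mul2r; apply/orP; right.
  apply: leq_trans (nbh_card _) _; rewrite leq_mul2r; apply/orP; right.
  by apply: leq_trans (nbh_card _) _; rewrite cards1 mul1n.
have [||w [_ wgood]] := local_lemma (w0 := [ffun=> set0]) mu_ge0 mu_sum1 loc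
    (fun j => bad_prob j _) few.
- have : 1 <= (D ^ 4)%N%:R :> R by rewrite (ler_nat R 1).
  by move: small; move: ((D ^ 4)%N%:R) => z; nra.
- by move: small; lra.
by exists w.
Qed.


(** * The state left by one round *)

Lemma survivors_le v w : th * Dl / n%:R <= dl -> ~~ bad_star v w ->
  #|survivors v w|%:R <= b * (1 - th - prate + 4 * dl).
Proof.
rewrite -ltNge; set S : R := #|_|%:R => cDl lt.
have S0 : 0 <= S by apply: ler0n.
have [ple p0] := (p_le_th, p_ge0).
have th12 : th <= 1 / 12.
  have : th * (12 * th) <= th * 1 by move: th2_le_dl dl_le_th; nra.
  by rewrite ler_pM2l //; lra.
(* A lower bound for [kap * hit_rate]. As [y ^+ 2 <= 4 * th ^+ 2] is at most [dl / 3], the quotient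
   [(1 + dl) / (1 + y)] is at most [1 - y + 2 * dl]. *)
pose y := th + prate - 2 * dl.
have x0l : th + prate - dl <= hit_rate by rewrite /hit_rate; lra.
have x0u : hit_rate <= 2 * th.
  rewrite /hit_rate; have : 0 <= th * Dl / n%:R; last by lra.
  by rewrite !mulr_ge0 ?invr_ge0 ?(ltW th_gt0) ?(ltW nR_gt0) // (le_trans _ Dl_ge1).
have yx : y <= kap * hit_rate.
  have : dl / (2 * th) * hit_rate <= dl / (2 * th) * (2 * th).
    by rewrite ler_wpM2l // divr_ge0 ?mulr_ge0 ?(ltW dl_gt0) ?(ltW th_gt0).
  rewrite divfK ?mulf_neq0 ?gt_eqF // /kap mulrBl mul1r /y; lra.
have y1 : 0 < 1 + y by rewrite /y; move: dl_le_th; lra.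
rewrite -(ler_pM2r y1); apply: (@le_trans _ _ (S * (1 + kap * hit_rate))).
  by rewrite ler_wpM2l // lerD2l.
apply: (le_trans (ltW lt)); rewrite [(1 + dl) * b]mulrC -mulrA ler_wpM2l ?(ltW b_gt0) //.
have yu : y <= 2 * th by rewrite /y; move: dl_gt0; lra.
have yl : - th <= y by rewrite /y; move: dl_le_th; lra.
have y2 : y ^+ 2 <= 4 * th ^+ 2 by move: th_gt0; nra.
have dy : dl * (- (1 / 12)) <= dl * y by rewrite ler_wpM2l ?(ltW dl_gt0) //; lra.
have -> : 1 - th - prate + 4 * dl = 1 - y + 2 * dl by rewrite /y; ring.
by move: th2_le_dl dl_gt0 y2; nra.
Qed.

(** Kept edges avoid all proposed vertices, including those of dummy and failed proposals, so a
    matching found among them can be completed by the successful proposals. *)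
Lemma nibble_core (B : nat) : (forall u, deg F u <= B)%N ->
  8 * ((1 + 2 * n * (1 + B)) ^ 4)%N%:R * expR (- decay) <= 1 ->
  th * Dl / n%:R <= dl ->
  exists (F' : {set W}) (A' : {set K}), [/\ F' \subset F,
    forall f, f \in F' -> col f \in A',
    forall k, k \in A' -> (1 - 2 * prate - dl) * n%:R <= #|cls col F' k|%:R,
    forall v, (deg F' v)%:R <= b * (1 - th - prate + 5 * dl) &
    full col F' A' -> full col F A].
Proof.
move=> dB small cDl; have [w wgood] := good_picks dB small.
pose D := \bigcup_i pick i (w i).
have subD i : pick i (w i) \subset D by apply: (bigcup_sup i).
have occD i : occupied i w \subset D.
  by apply/bigcupsP => j _; apply: subD.
pose succ k := (pick (inl k) (w (inl k)) != set0) &&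
  [disjoint pick (inl k) (w (inl k)) & occupied (inl k) w].
pose A' := [set k in A | ~~ succ k].
pose F' := [set f in F | (col f \in A') && [disjoint f & D]].
have sF : F' \subset F by apply/subsetP => f; rewrite inE => /andP[].
have clsF' k f : f \in cls col F' k -> f \in cls col F k by apply/subsetP/cls_sub.
have hitsD k : k \in A -> (class_hits k D)%:R <= (2 * prate + dl) * n%:R.
  move=> kA; have := wgood (inl k); rewrite /= /bad_class kA -ltNge => lt.
  apply: le_trans (ltW lt); rewrite -natr_sum ler_nat big_enum /=.
  apply: leq_trans (_ : #|\bigcup_i [set f in cls col F k |
      ~~ [disjoint f & pick i (w i)]]| <= _)%N.
    apply: subset_leq_card; apply/subsetP => f.
    rewrite inE => /andP[fk /pred0Pn[y /= /andP[yf /bigcupP[i _ yi]]]].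
    apply/bigcupP; exists i => //; rewrite inE fk /=.
    by apply/pred0Pn; exists y; rewrite /= yf yi.
  elim/big_ind2: _ => [||//]; first by rewrite cards0.
  by move=> X a Y c Xa Yc; apply: leq_trans (leq_card_setU _ _) _; apply: leq_add.
exists F', A'; split=> //.
- by move=> f; rewrite inE => /and3P[].
- move=> k kA'; have kA : k \in A by move: kA'; rewrite inE => /andP[].
  have -> : (1 - 2 * prate - dl) * n%:R = n%:R - (2 * prate + dl) * n%:R by ring.
  rewrite lerBlDr; apply: le_trans (lerD (lexx _) (hitsD k kA)).
  rewrite -natrD ler_nat -(cls_card cfg kA).
  apply: leq_trans (leq_card_setU _ _); apply: subset_leq_card.
  apply/subsetP => f fk; rewrite in_setU.
  case: (boolP [disjoint f & D]) => fD; last first.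
    by apply/orP; right; rewrite inE fk.
  apply/orP; left; move/clsP: fk => [fF ck]; apply/clsP; split=> //.
  by rewrite inE fF ck kA' fD.
- move=> v; have := wgood (inr v); rewrite /= negb_or => /andP[gs gf].
  have -> : b * (1 - th - prate + 5 * dl) = b * (1 - th - prate + 4 * dl) + dl * b by ring.
  (* A kept edge at [v] is a survivor unless its color proposed; being still unserved, that color
     then failed, which puts the edge in [Z]. *)
  pose Z := [set f in star v | fails (col f) w].
  apply: (@le_trans _ _ (#|survivors v w|%:R + #|Z|%:R)).
    rewrite -natrD ler_nat; apply: leq_trans (leq_card_setU _ _).
    apply: subset_leq_card; apply/subsetP => f; rewrite inE => /andP[fF' vf].
    move: (fF'); rewrite inE => /and3P[fF]; rewrite inE => /andP[kA nsucc] fD.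
    have fv : f \in star v by rewrite inE fF.
    rewrite in_setU; case: (eqVneq (pick (inl (col f)) (w (inl (col f)))) set0) => [pk|pk].
      apply/orP; left; rewrite inE fv; apply/allP => i _ /=.
      rewrite inE fv /= negb_or; apply/andP; split; last first.
        rewrite negbK; apply: disjointWl (disjointWr (subD i) fD); exact: subsetDl.
      case: i => // k; apply/negP => /andP[/eqP ck]; rewrite -ck pk eqxx //.
    apply/orP; right; rewrite inE fv /fails pk.
    by move: nsucc; rewrite negb_and pk.
  apply: lerD; first exact: survivors_le.
  move: gf; rewrite /bad_fail -ltNge => /ltW; apply: le_trans.
  rewrite big_enum big_sumType /= [X in _ + X]big1 // addr0.
  rewrite -sum1_card natr_sum (partition_big col xpredT) //=.
  apply: ler_sum => k _; case: (boolP (fails k w)) => fk; last first.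
    rewrite mulr0 big1 // => f /andP[fZ /eqP ck].
    by move: fZ; rewrite inE ck (negbTE fk) andbF.
  case: (boolP (k \in A)) => kA; last first.
    rewrite big1 ?mulr_ge0 // => f /andP[fZ /eqP ck].
    have fF : f \in F by move: fZ; rewrite !inE => /andP[/andP[]].
    by move: kA; rewrite -ck (col_in cfg fF).
  have -> : (class_hits k (occupied (inl k) w))%:R <= (2 * prate + dl) * n%:R.
    apply: le_trans (hitsD k kA); rewrite ler_nat; apply: subset_leq_card.
    apply/subsetP => f; rewrite !inE => /andP[->] /=; apply: contra.
    exact: disjointWr.
  rewrite mulr1 -natr_sum ler_nat /deg -sum1_card big_mkcond [leqRHS]big_mkcond /=.
  apply: leq_sum => f _; rewrite inE; case: eqP => [ck|_]; last by rewrite andbF.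
  by rewrite !inE ck eqxx !andbT; case: (f \in F); case: (v \in f); case: fails.
move=> [phi [phi1 phi2]].
exists (fun k => if succ k then pick (inl k) (w (inl k)) else phi k).
have phiD k : k \in A' -> [disjoint phi k & D].
  by move=> /phi1/clsP[]; rewrite inE => /and3P[].
split=> [k kA|k l kA lA kl].
  case: ifP => [/andP[/pick_neq0[wk ->] _]//|/negbT ns].
  by apply: clsF'; apply: phi1; rewrite inE kA ns.
have disD m m' : m \in A -> ~~ succ m ->
    [disjoint phi m & pick (inl m') (w (inl m'))].
  by move=> mA ns; apply: disjointWr (subD _) (phiD m _); rewrite inE mA ns.
have later m m' : succ m' -> before (inl m) (inl m') ->
    [disjoint pick (inl m) (w (inl m)) & pick (inl m') (w (inl m'))].
  move=> /andP[_]; rewrite disjoint_occupied => /forall_inP dm' mm'.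
  by rewrite disjoint_sym; apply: dm'.
case: ifP => sk; case: ifP => sl.
- have : index (inl k : I) (enum {: I}) != index (inl l : I) (enum {: I}).
    apply/negP => /eqP/(congr1 (nth (inl k : I) (enum {: I}))).
    rewrite !nth_index ?mem_enum // => -[] kl'; by rewrite kl' eqxx in kl.
  rewrite neq_ltn => /orP[lt|lt]; first exact: later.
  by rewrite disjoint_sym; apply: later.
- by rewrite disjoint_sym; apply: disD => //; rewrite sl.
- by apply: disD => //; rewrite sk.
by apply: phi2 => //; rewrite inE ?kA ?lA ?sk ?sl.
Qed.

End Nibble.

(** * Iterating the rounds *)

Section Iteration.
Variables (R : realType) (K T : finType) (col : {set T} -> K).
Implicit Types (F : {set {set T}}) (A : {set K}).

(** Only a lower bound on class sizes, since a round leaves them unequal; [sparse_config] trims them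
    again. *)
Definition sparse F A (a b Dl : R) : Prop :=
  [/\ forall f, f \in F -> #|f| = 2%N, forall f, f \in F -> col f \in A,
      forall k, k \in A -> a <= #|cls col F k|%:R,
      forall v, (deg F v)%:R <= b & forall k v, (deg (cls col F k) v)%:R <= Dl].

Lemma nat_ceil (a : R) : 0 < a -> exists n : nat,
  [/\ (0 < n)%N, a <= n%:R, n%:R < a + 1 & forall m : nat, a <= m%:R -> (n <= m)%N].
Proof.
move=> a0; have ex : exists n : nat, a <= n%:R.
  by exists (Num.truncn a).+1; apply/ltW; rewrite truncnS_gt.
case: (ex_minnP ex) => n an nmin; have n0 : (0 < n)%N.
  by rewrite -(ltr0n R); apply: lt_le_trans an.
exists n; split=> //.
rewrite -(prednK n0) -natr1 ltrD2r ltNge; apply/negP => /nmin.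
by rewrite -ltnS prednK // ltnn.
Qed.

Lemma sparse_config F A (a b Dl : R) : sparse F A a b Dl -> 0 < a ->
  exists n F', [/\ (0 < n)%N, a <= n%:R, n%:R < a + 1, config col F' A n b Dl &
    full col F' A -> full col F A].
Proof.
move=> [c2 ci ca db cd] /nat_ceil[n [n0 an na nmin]]; exists n.
have [|F' [cfg ext]] := truncate (n := n) c2 ci _ db cd; last by exists F'.
by move=> k kA; apply: nmin; apply: ca.
Qed.

Lemma bernoulli (x : R) (m : nat) : 0 <= x -> 1 + m%:R * x <= (1 + x) ^+ m.
Proof.
move=> x0; elim: m => [|m IH]; first by rewrite mul0r addr0 expr0.
rewrite exprS -natr1; apply: le_trans (ler_wpM2l _ IH); last by lra.
by have : 0 <= m%:R * x * x; [rewrite !mulr_ge0 | lra].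
Qed.

(** Here [1 + rho] is n / b and [r] is [prate]. Apart from [dl], the surplus is
    [(th - r) * (1 + rho) = th * rho], twice the gain needed; the errors are at most [6 * 33 * dl],
    which the 400 keeps below [rho * th / 2]. *)
Lemma ratio_gain (th dl eps rho r : R) :
  0 < th -> th <= 1 / 100 -> eps <= rho -> rho <= 32 -> 0 < eps ->
  dl = eps * th / 400 -> r * (1 + rho) = th -> 0 <= r -> r <= th ->
  (1 + eps * (1 + th / 2)) * (1 - th - r + 5 * dl)
    <= (1 - 2 * r - dl) * (1 + rho).
Proof.
move=> th0 th1 er r32 eps0 dlE rE r0 rth.
have eth : 0 <= eps * th by rewrite mulr_ge0 ?(ltW eps0) ?(ltW th0).
have ert : eps * th <= rho * th by rewrite ler_wpM2r ?(ltW th0).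
have dl0 : 0 <= dl by rewrite dlE; lra.
have dlt : dl * 12 <= th by rewrite dlE; nra.
set z := 1 - th - r + 5 * dl.
have z0 : 0 <= z by rewrite /z; lra.
have z1 : z <= 1 by rewrite /z; lra.
have rho0 : 0 <= rho by lra.
have eps_rho : eps * (1 + th / 2) <= rho * (1 + th / 2) by rewrite ler_wpM2r //; lra.
apply: (@le_trans _ _ ((1 + rho * (1 + th / 2)) * z)).
  by rewrite ler_wpM2r // lerD2l.
have zr : rho * th * z <= rho * th by rewrite ler_piMr // mulr_ge0 // ltW.
have dlr : dl * rho <= dl * 32 by rewrite ler_wpM2l.
have dl400 : dl * 400 <= rho * th by rewrite dlE; lra.
have -> : (1 + rho * (1 + th / 2)) * z = (1 + rho) * z + rho * th * z / 2 by field.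
have -> : (1 - 2 * r - dl) * (1 + rho) = (1 + rho) - 2 * (r * (1 + rho)) - dl - dl * rho.
  by ring.
have -> : (1 + rho) * z = (1 + rho) - th - th * rho - r * (1 + rho) + 5 * dl + 5 * (dl * rho).
  by rewrite /z; ring.
rewrite rE; move: zr dlr dl400; rewrite [th * rho]mulrC.
move: (rho * th * z) (dl * rho) (rho * th) => x1 x2 x3; lra.
Qed.

Lemma nibble_step F A (b Dl th eps LL : R) (Q : nat) :
  sparse F A ((1 + eps) * b) b Dl ->
  0 < th -> 100 * 100 * th <= eps -> eps <= 31 -> 1 <= Dl -> 1 <= b ->
  b <= Q%:R -> LL * Dl <= b * eps ^+ 2 * th -> 200 * 100 <= LL ->
  8 * ((140 * Q ^ 2) ^ 4)%N%:R * expR (- (LL / (100 * 100 * 1000))) <= 1 ->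
  exists F' A' b', [/\ sparse F' A' ((1 + eps * (1 + th / 2)) * b') b' Dl,
    b * (1 - 2 * th) <= b', b' <= b & full col F' A' -> full col F A].
Proof.
move=> sp th0 the eps31 Dl1 b1 bQ LLD LL0 small.
have b0 : 0 < b by lra.
have eps0 : 0 < eps by apply: lt_le_trans the; rewrite !mulr_gt0.
have a0 : 0 < (1 + eps) * b by rewrite mulr_gt0 // addr_gt0.
have [n [F1 [n0 an na cfg ext]]] := sparse_config sp a0.
have nR0 : 0 < n%:R :> R by rewrite ltr0n.
have th100 : th <= 1 / 100 by lra.
pose dl := eps * th / 400.
have eth0 : 0 < eps * th by apply: mulr_gt0.
have eth31 : eps * th <= 31 * th by rewrite ler_wpM2r // ltW.
have dl0 : 0 < dl by rewrite /dl; lra.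
have dlth : dl <= th by rewrite /dl; lra.
have th2 : 12 * th ^+ 2 <= dl.
  have : th * (100 * 100 * th) <= th * eps by rewrite ler_wpM2l // ltW.
  by rewrite /dl expr2; nra.
have bn : b <= n%:R by apply: le_trans an; nra.
(* Rounding up adds at most 1 <= [b] to [(1 + eps) * b <= 32 * b]. The 33 yields [rho <= 32] below,
   and also the 140, as [1 + 2 * n * (1 + Q) <= 1 + 132 * Q ^ 2]. *)
have n33 : n%:R <= 33 * b by apply: (le_trans (ltW na)); nra.
have dQ u : (deg F1 u <= Q)%N.
  by rewrite -(ler_nat R); apply: le_trans bQ; apply: (deg_le cfg).
have Dl0 : 0 < Dl by lra.
have LamE : decay b Dl th dl = b * eps ^+ 2 * th / Dl / (400 ^+ 2 * 32).
  by rewrite /decay /dl; field; rewrite !gt_eqF.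
have LamL : LL / (100 * 100 * 1000) <= decay b Dl th dl.
  have : LL <= b * eps ^+ 2 * th / Dl by rewrite ler_pdivlMr.
  rewrite LamE; move: (_ / Dl) => y; nra.
have Q1 : (0 < Q)%N by rewrite -(ltr0n R); lra.
have nQ : (n <= 33 * Q)%N.
  by rewrite -(ler_nat R) natrM; apply: le_trans n33 _; rewrite ler_wpM2l.
have small1 : 8 * ((1 + 2 * n * (1 + Q)) ^ 4)%N%:R * expR (- decay b Dl th dl) <= 1.
  apply: le_trans small; rewrite ler_pM ?mulr_ge0 ?expR_ge0 //; last first.
    by rewrite ler_expR lerN2.
  rewrite ler_wpM2l ?ler_nat // leq_exp2r; last by [].
  have nQQ : (n * (1 + Q) <= 66 * (Q * Q))%N.
    rewrite (_ : 66 * (Q * Q) = 33 * Q * (2 * Q))%N ?leq_mul //; last by ring.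
    by rewrite mul2n -addnn leq_add2r.
  have QQ : (0 < Q * Q)%N by rewrite muln_gt0 Q1.
  rewrite -mulnn -mulnA; move: (n * (1 + Q))%N (Q * Q)%N nQQ QQ => X Y.
  by move=> XY Y0; clear -XY Y0; lia.
have cDl : th * Dl / n%:R <= dl.
  rewrite ler_pdivrMr // /dl.
  have key : Dl * 400 <= eps * b.
    have : LL * Dl <= b * eps * (31 * (1 / 100)).
      apply: (le_trans LLD); rewrite expr2 mulrA -mulrA ler_wpM2l //.
        by rewrite mulr_ge0 ?(ltW b0) ?(ltW eps0).
      by rewrite ler_pM ?(ltW eps0) ?(ltW th0).
    have : 200 * 100 * Dl <= LL * Dl by rewrite ler_wpM2r // ltW.
    by rewrite [eps * b]mulrC; have := mulr_gt0 b0 eps0; nra.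
  have : eps * b <= eps * n%:R by rewrite ler_wpM2l // ltW.
  by nra.
have th1 : th <= 1 by lra.
have [F' [A' [sF ci' ca' da' ext']]] :=
  nibble_core cfg n0 b0 bn Dl1 th0 th1 dl0 dlth th2 dQ small1 cDl.
pose r := prate n b th; pose b' := b * (1 - th - r + 5 * dl).
have r0 : 0 <= r by rewrite /r /prate !mulr_ge0 ?invr_ge0 ?(ltW th0) ?(ltW b0) ?(ltW nR0).
have rth : r <= th by rewrite /r /prate ler_pdivrMr // ler_wpM2l // ltW.
have rn : r * (n%:R / b) = th by rewrite /r /prate; field; rewrite !gt_eqF.
exists F', A', b'; split; last by move=> /ext'/ext.
- split=> //.
  + by move=> f /(subsetP sF); apply: (card2 cfg).
  + move=> k /ca'; apply: le_trans; rewrite -/r.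
    have rho1 : eps <= n%:R / b - 1 by rewrite lerBrDl ler_pdivlMr.
    have rho2 : n%:R / b - 1 <= 32 by rewrite lerBlDr ler_pdivrMr //; lra.
    have rn' : r * (1 + (n%:R / b - 1)) = th by rewrite addrC subrK.
    have := ratio_gain th0 th100 rho1 rho2 eps0 erefl rn' r0 rth.
    rewrite -/dl [1 + (_ - 1)]addrC subrK => gain.
    have -> : (1 - 2 * r - dl) * n%:R = b * ((1 - 2 * r - dl) * (n%:R / b)).
      by field; rewrite gt_eqF.
    by rewrite /b' mulrCA ler_wpM2l // ltW.
  + move=> k v; apply: le_trans (cdeg_le cfg k v).
    by rewrite ler_nat deg_sub // cls_sub.
- by rewrite /b' ler_wpM2l ?(ltW b0) //; lra.
by rewrite /b' ler_piMr ?(ltW b0) // /dl; lra.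
Qed.

(** Induction on the rounds left, with [th] fixed. The lower bound on [b * eps ^+ 5], with
    [eps <= 32], keeps [b] large enough for every round. Rounds stop once [eps] reaches 31; the
    bound 32 leaves room for the last overshoot. *)
Lemma nibble_iterate (q Dl eps0 LL : R) (Q : nat) :
  0 < eps0 -> eps0 <= 1 -> 1 <= Dl -> q <= Q%:R -> 200 * 100 <= LL ->
  LL * Dl * (1000 * 1000 * 1000) <= q * eps0 ^+ 6 ->
  8 * ((140 * Q ^ 2) ^ 4)%N%:R * expR (- (LL / (100 * 100 * 1000))) <= 1 ->
  forall m F A (b eps : R), sparse F A ((1 + eps) * b) b Dl ->
  eps0 <= eps -> eps <= 32 -> b <= q -> q * eps0 ^+ 5 <= b * eps ^+ 5 ->
  31 <= eps * (1 + eps0 / (100 * 100) / 2) ^+ m -> full col F A.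
Proof.
move=> e0 e1 Dl1 qQ LL0 LLq small; set th := eps0 / (100 * 100).
have th0 : 0 < th by rewrite /th; lra.
have q5 : (1000 * 1000 * 1000) * (200 * 100) <= q * eps0 ^+ 5.
  have LD : LL * 1 <= LL * Dl by rewrite ler_wpM2l //; lra.
  have : q * eps0 ^+ 6 <= q * eps0 ^+ 5.
    have q0 : 0 <= q.
      rewrite -(pmulr_lge0 _ (exprn_gt0 6 e0)); apply: le_trans LLq; nra.
    by rewrite ler_wpM2l // ler_wiXn2l // ltW.
  by nra.
have b_ge1 b eps : 0 < eps -> eps <= 32 -> q * eps0 ^+ 5 <= b * eps ^+ 5 -> 1 <= b.
  move=> p0 p32 inv; have e5 : eps ^+ 5 <= 32 ^+ 5 by rewrite lerXn2r ?nnegrE // ltW.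
  have e50 : 0 < eps ^+ 5 by apply: exprn_gt0.
  rewrite -(ler_pM2r e50) mul1r; apply: le_trans inv; apply: le_trans q5; lra.
have dense F A b eps : sparse F A ((1 + eps) * b) b Dl -> 1 <= b -> 31 <= eps -> full col F A.
  move=> sp b1 e31; have a32 : 32 * b <= (1 + eps) * b by rewrite ler_wpM2r; lra.
  have [|n [F' [_ an _ cfg]]] := sparse_config sp; first lra.
  apply; apply: (full_of_dense cfg); [lra | | lra].
  by rewrite -(ler_nat R); lra.
elim=> [|m IH] F A b eps sp e0e e32 bq inv.
  rewrite expr0 mulr1 => e31; apply: (dense F A b eps) => //.
  by apply: b_ge1 inv => //; lra.
have p0 : 0 < eps by lra.
have b1 := b_ge1 _ _ p0 e32 inv.
move=> big; have [e31|/ltW e31] := leP 31 eps; first exact: (dense F A b eps).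
have the : 100 * 100 * th <= eps by rewrite /th; lra.
(* Write [b * eps ^+ 2 * th] as [b * eps ^+ 5] times [th / eps ^+ 3] and use [eps <= 31]; the
   billion in the hypothesis exceeds [31 ^+ 3 * (100 * 100)]. *)
have LLb : LL * Dl <= b * eps ^+ 2 * th.
  have e3 : eps ^+ 3 <= 31 ^+ 3 by rewrite lerXn2r ?nnegrE // ltW.
  have B0 : 0 <= b * eps ^+ 2 by rewrite mulr_ge0 ?sqr_ge0 //; lra.
  have step : q * eps0 ^+ 5 * (th * (100 * 100)) <= b * eps ^+ 2 * 31 ^+ 3 * (th * (100 * 100)).
    rewrite ler_wpM2r; [by []|by rewrite mulr_ge0 ?(ltW th0)|].
    by apply: (le_trans inv); rewrite (exprD eps 2 3) mulrA ler_wpM2l.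
  have thE : q * eps0 ^+ 6 = q * eps0 ^+ 5 * (th * (100 * 100)).
    by rewrite /th exprSr; field.
  have := mulr_ge0 B0 (ltW th0); rewrite -thE in step.
  move: step; have -> : b * eps ^+ 2 * 31 ^+ 3 * (th * (100 * 100))
    = b * eps ^+ 2 * th * (31 ^+ 3 * (100 * 100)) by ring.
  by move: LLq; move: (LL * Dl) (b * _ * th) (q * _) => x y z; lra.
have [F' [A' [b' [sp' b'l b'u ext]]]] :=
  nibble_step sp th0 the e31 Dl1 b1 (le_trans bq qQ) LLb LL0 small.
apply: ext; apply: (IH F' A' b' (eps * (1 + th / 2))) => //.
- by apply: (le_trans e0e); rewrite ler_peMr; lra.
- have : eps * (1 + th / 2) <= 31 * (1 + th / 2) by rewrite ler_wpM2r //; lra.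
  by rewrite /th; lra.
- exact: le_trans bq.
- apply: (le_trans inv); rewrite exprMn.
  (* Five is the least exponent whose first-order gain, 5/2 [th], beats the loss [2 * th] of [b]. *)
  have g : 1 <= (1 - 2 * th) * (1 + th / 2) ^+ 5.
    have th1 : th <= 1 / 100 by rewrite /th; lra.
    have h5 : 1 + 5 * (th / 2) <= (1 + th / 2) ^+ 5 by apply: bernoulli; lra.
    have : (1 - 2 * th) * (1 + 5 * (th / 2)) <= (1 - 2 * th) * (1 + th / 2) ^+ 5.
      by rewrite ler_wpM2l //; lra.
    by nra.
  have E0 : 0 <= b * eps ^+ 5 by rewrite mulr_ge0 ?exprn_ge0 //; lra.
  apply: (@le_trans _ _ (b * (1 - 2 * th) * (eps ^+ 5 * (1 + th / 2) ^+ 5))).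
    have -> : b * (1 - 2 * th) * (eps ^+ 5 * (1 + th / 2) ^+ 5) =
      b * eps ^+ 5 * ((1 - 2 * th) * (1 + th / 2) ^+ 5) by ring.
    by rewrite ler_peMr.
  rewrite ler_wpM2r // mulr_ge0 ?exprn_ge0 //; lra.
by apply: (le_trans big); rewrite exprS mulrA.
Qed.

End Iteration.

(** * The theorem *)

Lemma card_edge (T : finType) (e : rel T) (f : {set T}) :
  irreflexive e -> f \in edges e -> #|f| = 2%N.
Proof.
move=> irr /imsetP[[x y]]; rewrite inE /= => exy ->; rewrite cards2.
by case: eqP exy => // ->; rewrite irr.
Qed.

Lemma matching_of_full (T : finType) (e : rel T) (C : eqType) (c : {set T} -> C)
    (col : {set T} -> {set T}) :
  irreflexive e ->
  (forall f g, f \in edges e -> g \in edges e -> (col f == col g) = (c f == c g)) ->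
  full col (edges e) [set col f | f in edges e] ->
  exists M : {set {set T}},
    [/\ is_matching e M, rainbow c M & uses_every_color e c M].
Proof.
move=> irr colE [phi [phi1 phi2]].
set A := [set col f | f in edges e] in phi1 phi2.
have phiF k : k \in A -> phi k \in edges e /\ col (phi k) = k.
  by move=> /phi1/clsP.
exists (phi @: A); split.
- split; first by apply/subsetP => _ /imsetP[k /phiF[+ _] ->].
  apply/trivIsetP => _ _ /imsetP[k kA ->] /imsetP[l lA ->] kl.
  by apply: phi2 => //; apply: contraNneq kl => ->.
- move=> _ _ /imsetP[k kA ->] /imsetP[l lA ->] cc.
  have [[kF kk] [lF ll]] := (phiF k kA, phiF l lA).
  by congr phi; apply/eqP; rewrite -kk -ll colE // cc.
move=> k /mapP[f]; rewrite mem_enum => fF ->.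
have fA : col f \in A by apply: imset_f.
have [pF pc] := phiF _ fA.
apply/eqP/cards1P; exists (phi (col f)); apply/setP => g; rewrite !inE.
apply/andP/eqP => [[/imsetP[l lA ->]]|->]; last first.
  by split; [apply: imset_f | rewrite -colE // pc].
have [lF ll] := phiF _ lA.
by rewrite -colE // ll => /eqP->.
Qed.

Lemma scaled_le (R : realType) (c d A B y z : R) : 0 < A -> 0 < B -> 0 <= z ->
  d <= c -> c * A * B * z <= y -> d * z <= y / A / B.
Proof.
move=> A0 B0 z0 dc le_y; rewrite ler_pdivlMr // ler_pdivlMr //.
apply: le_trans le_y; rewrite -!mulrA [B * A]mulrC [z * _]mulrC -!mulrA.
by rewrite ler_wpM2r // !mulr_ge0 // ltW.
Qed.

Section Numerics.
Variables (R : realType) (q Delta : R).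
Hypothesis q_large : expR 100 <= q.
Hypothesis Delta_ge1 : 1 <= Delta.

Definition excess : R := powR (Delta ^+ 2 / q) (1 / 6) * ln q ^+ 2.

Let q_gt0 : 0 < q.
Proof. by apply: lt_le_trans q_large; apply: expR_gt0. Qed.

Let ln_ge : 100 <= ln q.
Proof. by rewrite -[100](@expRK R) ler_ln ?posrE ?expR_gt0. Qed.

Let Dq_gt0 : 0 < Delta ^+ 2 / q.
Proof. by rewrite divr_gt0 // exprn_gt0 // (lt_le_trans _ Delta_ge1). Qed.

Lemma excess_gt0 : 0 < excess.
Proof.
by rewrite mulr_gt0 ?powR_gt0 // exprn_gt0 // (lt_le_trans _ ln_ge).
Qed.

(** This explains the exponent 1/6: the iteration needs the product [q * eps0 ^+ 6] to be large. *)
Lemma excess6 : q * excess ^+ 6 = Delta ^+ 2 * ln q ^+ 12.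
Proof.
have root6 : powR (Delta ^+ 2 / q) (1 / 6) ^+ 6 = Delta ^+ 2 / q.
  rewrite -(powR_mulrn 6 (powR_ge0 _ _)) -powRrM.
  have -> : 1 / 6 * 6%:R = 1 :> R by rewrite mul1r mulVf // pnatr_eq0.
  by rewrite powRr1 // ltW.
rewrite /excess exprMn root6 -exprM mulrA; congr (_ * _).
by rewrite mulrC divfK // gt_eqF.
Qed.

Lemma excess_le1 : Delta <= Num.sqrt q / ln q ^+ 9 -> excess <= 1.
Proof.
move=> Dq; have l0 : 0 < ln q by apply: lt_le_trans ln_ge.
have D0 : 0 <= Delta by apply: le_trans Delta_ge1.
have DL : Delta ^+ 2 * ln q ^+ 18 <= q.
  have : Delta * ln q ^+ 9 <= Num.sqrt q by rewrite -ler_pdivlMr // exprn_gt0.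
  move=> h; rewrite -[leRHS](sqr_sqrtr (ltW q_gt0)).
  have -> : Delta ^+ 2 * ln q ^+ 18 = (Delta * ln q ^+ 9) ^+ 2.
    by rewrite exprMn -exprM.
  by rewrite lerXn2r ?nnegrE ?sqrtr_ge0 // mulr_ge0 // exprn_ge0 // ltW.
rewrite -(@expr_le1 _ 6) ?(ltW excess_gt0) // -(ler_pM2l q_gt0) excess6 mulr1.
apply: le_trans DL; rewrite ler_wpM2l ?exprn_ge0 //.
by rewrite ler_eXn2l //; move: ln_ge; lra.
Qed.

(** The polynomial factor is at most [q ^+ 9], that is exp([9 * ln q]), and [ln q ^+ 11] is at least
    10^22 while the denominators multiply to 10^16. *)
Lemma final_slack : exists Q : nat, q <= Q%:R /\
  8 * ((140 * Q ^ 2) ^ 4)%N%:R *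
    expR (- (ln q ^+ 12 / (1000 * 1000 * 1000) / (100 * 100 * 1000))) <= 1.
Proof.
have [Q [Q0 qQ Qq _]] := nat_ceil q_gt0; exists Q; split; first exact: qQ.
have q1 : 1 <= q.
  by apply: le_trans q_large; rewrite -(expR0 R) ler_expR.
have Q2 : Q%:R <= 2 * q by lra.
have l0 : 0 < ln q by apply: lt_le_trans ln_ge.
have big : 8 * 560 ^+ 4 <= q.
  (* Read exp(100) as the 20th power of exp(5) >= 6, whose fourth power already exceeds both 8 and
     560. *)
  apply: le_trans q_large; have -> : 100 = 20%:R * 5 :> R by rewrite -natrM.
  have gen (s u E : R) : 0 <= s -> 0 <= u -> s <= E ^+ 4 -> u <= E ^+ 4 ->
      s * u ^+ 4 <= E ^+ 20.
    move=> s0 u0 sE uE; have E4 : 0 <= E ^+ 4 by apply: le_trans sE.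
    rewrite (exprD E 4 16) (exprM E 4 4).
    by apply: ler_pM; rewrite ?exprn_ge0 //; apply: lerXn2r uE.
  have c6 : 6 <= expR 5 :> R by apply: le_trans (expR_ge1Dx _); lra.
  have E4 : 560 <= expR 5 ^+ 4 :> R.
    have : 36 <= expR 5 ^+ 2 :> R by rewrite expr2; nra.
    by rewrite (exprM _ 2 2); move: (expR 5 ^+ 2) => y; rewrite expr2; nra.
  rewrite expRM_natl; apply: (gen _ _ _ _ _ _ E4); [exact: ler0n | exact: ler0n |].
  by apply: le_trans E4; lra.
have poly_le : 8 * ((140 * Q ^ 2) ^ 4)%N%:R <= q ^+ 9.
  rewrite natrX natrM natrX.
  have Qq2 : 140%:R * Q%:R ^+ 2 <= 560 * q ^+ 2.
    have : Q%:R ^+ 2 <= (2 * q) ^+ 2.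
      by apply: lerXn2r Q2; rewrite nnegrE ?mulr_ge0 // ltW.
    by rewrite exprMn; move: (Q%:R ^+ 2) (q ^+ 2) => x y; lra.
  apply: (@le_trans _ _ (8 * (560 * q ^+ 2) ^+ 4)).
    apply: ler_wpM2l; first exact: ler0n.
    have Q20 : 0 <= 140%:R * Q%:R ^+ 2 :> R.
      exact: mulr_ge0 (ler0n _ _) (exprn_ge0 _ (ler0n _ _)).
    by apply: (lerXn2r _ _ _ Qq2); rewrite nnegrE; [|apply: le_trans Qq2].
  rewrite exprMn -exprM mulrA (exprD q 1 8) expr1; apply: ler_wpM2r big.
  by rewrite exprn_ge0 // ltW.
have q9 : q ^+ 9 = expR (9 * ln q) by rewrite expRM_natl lnK ?posrE.
apply: (le_trans (ler_wpM2r (expR_ge0 _) poly_le)).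
rewrite q9 -expRD -[leRHS](expR0 R) ler_expR subr_le0.
have l11 : 100 ^+ 11 <= ln q ^+ 11.
  by rewrite lerXn2r ?nnegrE ?(ltW l0).
have scale : 100 ^+ 11
    = (100 * 100 * 100) * (1000 * 1000 * 1000) * (100 * 100 * 1000) :> R by ring.
have : 100 ^+ 11 * ln q <= ln q ^+ 11 * ln q by rewrite ler_wpM2r // ltW.
have A0 : 0 < 1000 * 1000 * 1000 :> R by lra.
have B0 : 0 < 100 * 100 * 1000 :> R by lra.
rewrite -exprSr {}scale; move=> le_y.
by apply: (scaled_le A0 B0 (ltW l0) _ le_y); lra.
Qed.

End Numerics.

Theorem theorem1p9 (R : realType) :
  exists N : R, forall q Delta : R,
    N <= q -> 1 <= Delta -> Delta <= Num.sqrt q / ln q ^+ 9 ->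
    forall (T : finType) (e : rel T) (C : eqType) (c : {set T} -> C),
      symmetric e -> irreflexive e ->
      (max_degree e)%:R <= q ->
      (forall k : C, k \in colors e c ->
        (1 + powR (Delta ^+ 2 / q) (1 / 6) * ln q ^+ 2) * q
          <= #|color_class e c k|%:R) ->
      (forall (k : C) (x : T), (color_degree e c k x)%:R <= Delta) ->
      exists M : {set {set T}},
        [/\ is_matching e M, rainbow c M & uses_every_color e c M].
Proof.
exists (expR 100) => q Delta qN D1 Dq T e C c _ irr degq classes cdeg.
(* [C] need not be finite, so a color is replaced by a chosen edge of that color. *)
pose col (f : {set T}) := odflt set0 [pick g in edges e | c g == c f].
have colE f g : f \in edges e -> g \in edges e -> (col f == col g) = (c f == c g).
  move=> fF gF; apply/eqP/eqP => [|cfg]; last first.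
    by rewrite /col; congr odflt; apply: eq_pick => h; rewrite cfg.
  rewrite /col; case: pickP => [h /andP[_ /eqP <-]|/(_ f)]; last by rewrite fF eqxx.
  by case: pickP => [h' /andP[_ /eqP <-] /= ->|/(_ g)]; last by rewrite gF eqxx.
apply: (matching_of_full irr colE).
set A := [set col f | f in edges e].
have clsE f : f \in edges e -> cls col (edges e) (col f) = color_class e c (c f).
  move=> fF; apply/setP => g; rewrite !inE.
  by case: (boolP (g \in edges e)) => //= gF; rewrite colE.
pose eps := excess q Delta.
have e0 : 0 < eps := excess_gt0 qN D1.
have e1 : eps <= 1 := excess_le1 qN D1 Dq.
have q0 : 0 < q by apply: lt_le_trans qN; apply: expR_gt0.
have ln100 : 100 <= ln q by rewrite -[100](@expRK R) ler_ln ?posrE ?expR_gt0.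
have sp : sparse col (edges e) A ((1 + eps) * q) q Delta.
  split.
  - by move=> f; apply: card_edge.
  - by move=> f fF; apply: imset_f.
  - move=> _ /imsetP[f fF ->]; rewrite clsE //; apply: classes.
    by apply/mapP; exists f; rewrite ?mem_enum.
  - move=> v; apply: le_trans degq; rewrite ler_nat.
    exact: (leq_bigmax (F := degree e)).
  - move=> k v; case: (boolP (k \in A)) => [/imsetP[f fF ->]|kA].
      by rewrite clsE //; apply: cdeg.
    rewrite /deg (_ : [set _ in _ | _] = set0) ?cards0 ?(le_trans _ D1) //.
    apply/setP => f; rewrite [RHS]inE; apply/negbTE/negP.
    rewrite inE => /andP[/clsP[fF fk] _].
    by move: kA; rewrite -fk imset_f.
have [Q [qQ small]] := final_slack qN.
pose th := eps / (100 * 100).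
(* Bernoulli's linear growth suffices: every round succeeds for certain, so the number of rounds may
   be arbitrary. *)
have [m big] : exists m : nat, 31 <= eps * (1 + th / 2) ^+ m.
  have th0 : 0 < th / 2 by rewrite /th; lra.
  exists (Num.truncn (31 / eps / (th / 2))).+1.
  have := truncnS_gt (31 / eps / (th / 2)); set m := _.+1.
  rewrite ltr_pdivrMr // ltr_pdivrMr // => /ltW mbig.
  apply: (le_trans mbig); rewrite mulrC ler_wpM2l ?(ltW e0) //.
  by apply: le_trans (bernoulli _ (ltW th0)); rewrite lerDr.
(* The start [b = q], [eps = eps0] meets the invariants with equality. [small] fixes [LL] as
   [ln q ^+ 12] over a billion, and [Delta <= Delta ^+ 2] gives the condition on it. *)
apply: (nibble_iterate e0 e1 D1 qQ _ _ small sp _ _ _ _ big) => //.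
- have : 100 ^+ 12 <= ln q ^+ 12 by rewrite lerXn2r ?nnegrE // (le_trans _ ln100).
  by move: (ln q ^+ 12) => y; lra.
- rewrite excess6 //; set L := ln q ^+ 12.
  have L0 : 0 <= L by rewrite exprn_ge0 // (le_trans _ ln100).
  have -> : L / (1000 * 1000 * 1000) * Delta * (1000 * 1000 * 1000) = Delta * L.
    by field.
  by rewrite ler_wpM2r // expr2 ler_peMr // (le_trans _ D1).
by apply: le_trans e1 _; lra.
Qed.
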